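(* Let $X=G/K$ be one of the following compact rank one symmetric spaces with the indicated realization: $$S^{n}=\tfrac{\mathrm{SO}(n+1)}{\mathrm{SO}(n)}\ (n\ge 2),\quad P^n(\mathbb{C})=\tfrac{\mathrm{SU}(n+1)}{\mathrm{S}(\mathrm{U}(n)\times\mathrm{U}(1))},\quad P^n(\mathbb{H})=\tfrac{\mathrm{Sp}(n+1)}{\mathrm{Sp}(n)\times\mathrm{Sp}(1)},\quad P^2(\mathbb{O})=\tfrac{\mathrm{F}_4}{\mathrm{Spin}(9)}.$$ Given $\varepsilon>0$, there is a positive integer $N=N(X,\varepsilon)$ such that, for all finite subgroups $\Gamma_1,\Gamma_2$ of $G$ with $|\Gamma_i|^{-1}>\varepsilon$ for $i=1,2$, the orbifolds $\Gamma_1\backslash X$ and $\Gamma_2\backslash X$ are isospectral if and only if they have the same first $N$ eigenvalues (counted with multiplicities).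
   Context: $X$ carries its $G$-invariant symmetric Riemannian metric, normalized so that the sectional curvature is constantly one for $S^n$ and satisfies $1\le \sec\le 4$ in the remaining cases. $G$ acts on $X$ by isometries, and for a finite subgroup $\Gamma\subset G$, $\Gamma\backslash X$ is a Riemannian good orbifold. Its Laplace-Beltrami operator is that of $X$ restricted to $\Gamma$-invariant functions, and its spectrum is the multiset of eigenvalues counted with multiplicity. The eigenvalues are listed in increasing order with multiplicity, $0=\lambda_0<\lambda_1\le\lambda_2\le\cdots$. Two orbifolds are isospectral if their spectra coincide. *)

(* Defs.v *)
From HB Require Import structures.
From mathcomp Require Import all_boot all_order all_algebra finmap ring.
From mathcomp Require Import complex.
From mathcomp Require Import all_classical all_reals all_analysis.
Set Implicit Arguments.
Unset Strict Implicit.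
Unset Printing Implicit Defensive.
Import Order.TTheory GRing.Theory Num.Theory.
Import numFieldNormedType.Exports.
Local Open Scope classical_set_scope.
Local Open Scope ring_scope.

(* [(a, b, c, d)] is a + b i + c j + d k.  The alias keeps the Hamilton product
   apart from the componentwise product that [R * R * R * R] already carries. *)
Definition quat (R : realType) : Type := (R^o * R^o * R^o * R^o)%type.

HB.instance Definition _ (R : realType) :=
  GRing.Lmodule.copy (quat R) (R^o * R^o * R^o * R^o)%type.

Definition qmul (R : realType) (x y : quat R) : quat R :=
  let: (a, b, c, d) := x in let: (a', b', c', d') := y in
  (a * a' - b * b' - c * c' - d * d',
   a * b' + b * a' + c * d' - d * c',
   a * c' - b * d' + c * a' + d * b',
   a * d' + b * c' - c * b' + d * a').

Definition qone (R : realType) : quat R := (1, 0, 0, 0).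

Lemma qmulA (R : realType) : associative (@qmul R).
Proof.
by move=> [[[a b] c] d] [[[a' b'] c'] d'] [[[a2 b2] c2] d2] /=;
  congr (_, _, _, _); ring.
Qed.

Lemma qmul1l (R : realType) : left_id (qone R) (@qmul R).
Proof. by move=> [[[a b] c] d] /=; congr (_, _, _, _); ring. Qed.

Lemma qmul1r (R : realType) : right_id (qone R) (@qmul R).
Proof. by move=> [[[a b] c] d] /=; congr (_, _, _, _); ring. Qed.

Lemma qmulDl (R : realType) : left_distributive (@qmul R) +%R.
Proof.
by move=> [[[a b] c] d] [[[a' b'] c'] d'] [[[a2 b2] c2] d2] /=;
  congr (_, _, _, _); rewrite /=; ring.
Qed.

Lemma qmulDr (R : realType) : right_distributive (@qmul R) +%R.
Proof.
by move=> [[[a b] c] d] [[[a' b'] c'] d'] [[[a2 b2] c2] d2] /=;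
  congr (_, _, _, _); rewrite /=; ring.
Qed.

Lemma qone_neq0 (R : realType) : qone R != 0.
Proof. by apply/eqP => -[] /eqP; rewrite oner_eq0. Qed.

HB.instance Definition _ (R : realType) :=
  GRing.Zmodule_isNzRing.Build (quat R)
    (@qmulA R) (@qmul1l R) (@qmul1r R) (@qmulDl R) (@qmulDr R) (@qone_neq0 R).

Definition qconj (R : realType) (x : quat R) : quat R :=
  let: (a, b, c, d) := x in (a, - b, - c, - d).

(* Cayley-Dickson doubling: [(a, b)] is a + b l. *)
Definition oct (R : realType) : Type := (quat R * quat R)%type.

Definition omul (R : realType) (x y : oct R) : oct R :=
  (x.1 * y.1 - qconj y.2 * x.2, y.2 * x.1 + x.2 * qconj y.1).

Definition oconj (R : realType) (x : oct R) : oct R := (qconj x.1, - x.2).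

Definition oreal (R : realType) (a : R) : oct R := ((a, 0, 0, 0), 0).

Definition ore (R : realType) (x : oct R) : R := x.1.1.1.1.

Definition ccoord (R : realType) (z : R[i]) : 'rV[R]_2 :=
  \row_k [:: complex.Re z; complex.Im z]`_k.

Definition qcoord (R : realType) (x : quat R) : 'rV[R]_4 :=
  let: (a, b, c, d) := x in \row_k [:: a; b; c; d]`_k.

Definition ocoord (R : realType) (x : oct R) : 'rV[R]_(4 + 4) :=
  row_mx (qcoord x.1) (qcoord x.2).

(* Sends a matrix A over C, H or O to a vector of squared Euclidean norm
   (1/2) \sum_(i, j) `|A i j|^2. *)
Definition flatten_mx (R : realType) (K : Type) (d : nat) (coord : K -> 'rV[R]_d)
    (n : nat) (A : 'M[K]_n) : 'rV[R]_(n * n * d) :=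
  Num.sqrt 2^-1 *: mxvec (\matrix_(i < n * n) coord (mxvec A 0 i)).

Definition dot (R : realType) (N : nat) (x y : 'rV[R]_N) : R :=
  \sum_(i < N) x 0 i * y 0 i.

Fixpoint Ck (R : realType) (V W : normedModType R) (k : nat) (F : V -> W) : Prop :=
  match k with
  | 0 => continuous F
  | k'.+1 => (forall x, differentiable F x) /\
             (forall v, Ck k' (fun x => 'D_v F x))
  end.

Definition smooth (R : realType) (V W : normedModType R) (F : V -> W) : Prop :=
  forall k, Ck k F.

Definition tangent (R : realType) (N : nat) (M : set 'rV[R]_N)
    (x v : 'rV[R]_N) : Prop :=
  exists c : R -> 'rV[R]_N,
    [/\ c 0 = x, (forall t, M (c t)) & is_derive (0 : R) (1 : R) c v].

Definition tangent_frame (R : realType) (N : nat) (M : set 'rV[R]_N)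
    (x : 'rV[R]_N) (d : nat) (e : 'M[R]_(d, N)) : Prop :=
  e *m e^T = 1%:M /\ (forall v, tangent M x v <-> (v <= e)%MS).

(* [V] is a smooth extension to the ambient space of the Riemannian gradient
   of F restricted to M. *)
Definition tangential_gradient (R : realType) (N : nat) (M : set 'rV[R]_N)
    (F : 'rV[R]_N -> R) (V : 'rV[R]_N -> 'rV[R]_N) : Prop :=
  smooth V /\
  forall x, M x -> tangent M x (V x) /\
    (forall v, tangent M x v -> 'D_v F x = dot (V x) v).

(* The Levi-Civita connection of M is the tangential part of the ambient
   derivative, so for a tangent field V the divergence on M is the sum over an
   orthonormal tangent frame e of <D_e V, e>. *)
Definition has_divergence (R : realType) (N : nat) (M : set 'rV[R]_N)
    (V : 'rV[R]_N -> 'rV[R]_N) (x : 'rV[R]_N) (r : R) : Prop :=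
  exists (d : nat) (e : 'M[R]_(d, N)), tangent_frame M x e /\
    r = \sum_(i < d) dot ('D_(row i e) V x) (row i e).

(* The points [pts] form, through [emb], a submanifold of Euclidean space, and
   carry the induced Riemannian metric.  The group is the set [grp] of elements
   of [elt] with the operations [gmul] and [gone]. *)
Record gspace (R : realType) : Type := GSpace {
  point : Type;
  pts : set point;
  edim : nat;
  emb : point -> 'rV[R]_edim;
  elt : choiceType;
  grp : set elt;
  gone : elt;
  gmul : elt -> elt -> elt;
  act : elt -> point -> point }.
Arguments pts {R} _.
Arguments grp {R} _.
Arguments gone {R} _.

Definition finite_subgroup (R : realType) (X : gspace R) (Gam : {fset elt X}) : Prop :=
  [/\ [set` Gam] `<=` grp X,
      gone X \in Gam,
      (forall g h, g \in Gam -> h \in Gam -> gmul g h \in Gam)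
    & (forall g, g \in Gam ->
         exists2 h, h \in Gam & gmul g h = gone X /\ gmul h g = gone X)].

(* [h] is div (grad f) on X. *)
Definition is_laplacian (R : realType) (X : gspace R) (f h : point X -> R) : Prop :=
  let M := @emb R X @` pts X in
  exists (F : 'rV[R]_(edim X) -> R) (V : 'rV[R]_(edim X) -> 'rV[R]_(edim X)),
    [/\ smooth F,
        (forall p, pts X p -> f p = F (emb p)),
        tangential_gradient M F V
      & (forall p, pts X p -> has_divergence M V (emb p) (h p))].

Definition eigenfunction (R : realType) (X : gspace R) (Gam : {fset elt X})
    (lam : R) (f : point X -> R) : Prop :=
  (forall g p, g \in Gam -> pts X p -> f (act g p) = f p) /\
  is_laplacian f (fun p => - (lam * f p)).

Definition dim_eigenspace_ge (R : realType) (X : gspace R) (Gam : {fset elt X})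
    (lam : R) (m : nat) : Prop :=
  exists f : 'I_m -> point X -> R,
    (forall i, eigenfunction Gam lam (f i)) /\
    (forall c : 'I_m -> R,
       (forall p, pts X p -> \sum_(i < m) c i * f i p = 0) -> forall i, c i = 0).

Definition multiplicity (R : realType) (X : gspace R) (Gam : {fset elt X})
    (lam : R) (m : nat) : Prop :=
  dim_eigenspace_ge Gam lam m /\ ~ dim_eigenspace_ge Gam lam m.+1.

Definition isospectral (R : realType) (X : gspace R) (Gam1 Gam2 : {fset elt X}) : Prop :=
  forall (lam : R) (m : nat), multiplicity Gam1 lam m <-> multiplicity Gam2 lam m.

(* [u] lists the eigenvalues in increasing order, each one repeated according to
   its multiplicity. *)
Definition eigenvalue_list (R : realType) (X : gspace R) (Gam : {fset elt X})
    (u : nat -> R) : Prop :=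
  (forall i j, (i <= j)%N -> u i <= u j) /\
  (forall lam, exists2 m, multiplicity Gam lam m & ([set k | u k = lam] #= `I_m)%card).

Definition sphere (R : realType) (n : nat) : gspace R :=
  @GSpace R 'cV[R]_n.+1 [set x | \sum_i x i 0 ^+ 2 = 1] n.+1 (fun x => x^T)
    'M[R]_n.+1 [set g | g *m g^T = 1%:M /\ \det g = 1] 1%:M
    (fun g h => g *m h) (fun g x => g *m x).

Definition adjoint_mx (K : Type) (conj : K -> K) (n : nat) (A : 'M[K]_n) : 'M[K]_n :=
  (map_mx conj A)^T.

(* A line of K^n is represented by the orthogonal projection onto it, i.e. by a
   Hermitian idempotent of trace 1. *)
Definition rank1_projections (K : nzRingType) (conj : K -> K) (n : nat) : set 'M[K]_n :=
  [set p | [/\ adjoint_mx conj p = p, p *m p = p & \tr p = 1]].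

Definition unitary_group (K : nzRingType) (conj : K -> K) (n : nat) : set 'M[K]_n :=
  [set g | g *m adjoint_mx conj g = 1%:M /\ adjoint_mx conj g *m g = 1%:M].

(* With the metric (1/2) \sum_(i, j) `|dp i j|^2 the geodesic through the
   projections onto cos(t) e_0 + sin(t) e_1 has unit speed and length pi, which
   is the normalisation 1 <= sec <= 4; likewise over H and O. *)
Definition complex_projective (R : realType) (n : nat) : gspace R :=
  @GSpace R 'M[R[i]]_n.+1 (rank1_projections (@conjc R) (n := n.+1))
    _ (flatten_mx (@ccoord R) (n := n.+1))
    'M[R[i]]_n.+1
    [set g | unitary_group (@conjc R) g /\ \det g = 1] 1%:M
    (fun g h => g *m h) (fun g p => g *m p *m adjoint_mx (@conjc R) g).

Definition quaternionic_projective (R : realType) (n : nat) : gspace R :=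
  @GSpace R 'M[quat R]_n.+1 (rank1_projections (@qconj R) (n := n.+1))
    _ (flatten_mx (@qcoord R) (n := n.+1))
    'M[quat R]_n.+1 (unitary_group (@qconj R) (n := n.+1)) 1%:M
    (fun g h => g *m h) (fun g p => g *m p *m adjoint_mx (@qconj R) g).

(* The Albert algebra: [((a1, a2, a3), (x1, x2, x3))] stands for the Hermitian
   matrix
      a1       x3       conj x2
      conj x3  a2       x1
      x2       conj x1  a3      *)
Definition albert (R : realType) : Type :=
  ((R^o * R^o * R^o) * (oct R * oct R * oct R))%type.

Definition albert_mx (R : realType) (x : albert R) : 'M[oct R]_3 :=
  let: ((a1, a2, a3), (x1, x2, x3)) := x in
  \matrix_(i < 3, j < 3)
    nth 0 (nth [::]
      [:: [:: oreal a1; x3; oconj x2];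
          [:: oconj x3; oreal a2; x1];
          [:: x2; oconj x1; oreal a3]] i) j.

Definition mx_albert (R : realType) (A : 'M[oct R]_3) : albert R :=
  let k := fun i : nat => inord i : 'I_3 in
  ((ore (A (k 0) (k 0)), ore (A (k 1) (k 1)), ore (A (k 2) (k 2))),
   (A (k 1) (k 2), A (k 2) (k 0), A (k 0) (k 1)))%N.

Definition omulmx (R : realType) (A B : 'M[oct R]_3) : 'M[oct R]_3 :=
  \matrix_(i, j) \sum_k omul (A i k) (B k j).

(* (AB + BA) / 2 is Hermitian, so [mx_albert] loses no entry of it. *)
Definition jordan (R : realType) (x y : albert R) : albert R :=
  2^-1 *: mx_albert (omulmx (albert_mx x) (albert_mx y) +
                     omulmx (albert_mx y) (albert_mx x)).

Definition albert_tr (R : realType) (x : albert R) : R :=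
  x.1.1.1 + x.1.1.2 + x.1.2.

Definition F4 (R : realType) : set (albert R -> albert R) :=
  [set g | [/\ linear g, bijective g & {morph g : x y / jordan x y}]].

Definition octonionic_plane (R : realType) : gspace R :=
  @GSpace R (albert R) [set p | jordan p p = p /\ albert_tr p = 1]
    _ (fun p => flatten_mx (@ocoord R) (albert_mx p))
    (albert R -> albert R) (@F4 R) idfun
    (fun g h => g \o h) (fun g p => g p).

Inductive cross (R : realType) : gspace R -> Prop :=
  | cross_sphere n of (2 <= n)%N : cross (sphere R n)
  | cross_complex n of (1 <= n)%N : cross (complex_projective R n)
  | cross_quaternionic n of (1 <= n)%N : cross (quaternionic_projective R n)
  | cross_octonionic : cross (octonionic_plane R).

(* Main.v *)
Require Import Defs.
From HB Require Import structures.
From mathcomp Require Import all_boot all_order all_algebra finmap ring lra.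
From mathcomp Require Import complex.
From mathcomp Require Import all_classical all_reals all_analysis.
Import Order.TTheory GRing.Theory Num.Theory.
Import numFieldNormedType.Exports.
Set Implicit Arguments.
Unset Strict Implicit.
Unset Printing Implicit Defensive.
Local Open Scope classical_set_scope.
Local Open Scope ring_scope.

(** Up to conjugation by isometries of X there are finitely many finite groups
    acting on X with order below a given bound, and conjugate groups have the
    same spectrum.  So only finitely many eigenvalue lists occur, and N can be
    taken beyond the first place at which any two different lists differ.  An
    eigenvalue list and the multiplicity function of the spectrum determine
    each other ([isospectral_eigenvalue_list], [eigenvalue_list_isospectral]),
    which gives both directions of the equivalence.  The eigenfunctions
    themselves never have to be computed.

    Conjugacy.  Every space X of the list sits in a Euclidean space on which the
    group acts through orthogonal matrices that preserve a bilinear product B,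
    and every orthogonal matrix preserving B maps X to itself
    ([linear_model]).  For the sphere B is zero; for the complex and quaternionic
    projective spaces, whose points are the rank one Hermitian projections, B is
    (x, y) |-> x y^*; for the octonionic plane it is the Jordan product of the
    Albert algebra.  The matrices preserving B form a compact group
    ([isometries_compact]).  The multiplication table of a finite group and
    approximate values of its matrices take finitely many values, so it is
    enough that two homomorphisms r, r' of the same finite group into the
    isometries of B are conjugate as soon as they are close
    ([isometries_rigid]).

    Rigidity.  Let A be the average of r'(g)^T r(g).  It is close to the identity
    and satisfies r'(g)^T A r(g) = A, so the linear function x |-> tr (A^T x) on
    the isometries of B is invariant under x |-> r'(g)^T x r(g).  If its maximum
    is attained at only one point x, then x is fixed, that is x r(g) = r'(g) x.
    Uniqueness ([maximizer_unique]) is a strict concavity argument: two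
    maximizers x and y are close, so x^T y has a square root s near the identity
    that again preserves B ([isometries_sqrt]), and at the midpoint x s the
    function would be larger.  The root s preserves B because the defect
    D(u, v) = B(u s, v s) - B(u, v) s satisfies D(u s, v s) = - D(u, v) s, which is
    impossible near the identity unless D is zero.

    Conjugate groups.  A right multiplication by an orthogonal matrix that
    preserves the submanifold carries extensions, gradients, tangent frames and
    divergences to each other ([dim_eigenspace_conj]).

    The octonionic plane asks for one more fact: Jordan automorphisms are
    orthogonal, which amounts to the invariance of the trace ([F4_tr]).  The
    Albert algebra is spanned by 1 and the elements y o (x o z) - x o (y o z), on
    which the trace vanishes ([associator_ind], [albert_tr_associator]), and both
    properties are respected by automorphisms. *)

(** * The maximum norm of real matrices *)

Section MatrixNorm.
Variable R : realType.

Lemma entry_le_norm m n (A : 'M[R]_(m, n)) i j : `|A i j| <= `|A|.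
Proof.
rewrite [leRHS]/Num.Def.normr/= mx_normrE.
exact: (le_bigmax _ (fun ij : 'I_m * 'I_n => `|A ij.1 ij.2|) (i, j)).
Qed.

Lemma mx_norm_le m n (A : 'M[R]_(m, n)) c :
  0 <= c -> (forall i j, `|A i j| <= c) -> `|A| <= c.
Proof.
by move=> c0 Ac; rewrite [leLHS]/Num.Def.normr/= mx_normrE bigmax_le.
Qed.

Lemma mx_norm_mul m n p (A : 'M[R]_(m, n)) (B : 'M[R]_(n, p)) :
  `|A *m B| <= n%:R * (`|A| * `|B|).
Proof.
apply: mx_norm_le => [|i j]; first by rewrite !mulr_ge0.
rewrite mxE (le_trans (ler_norm_sum _ _ _))//.
rewrite [leRHS](_ : _ = \sum_(k < n) `|A| * `|B|) ?ler_sum// => [k _|]; last first.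
  by rewrite sumr_const card_ord mulr_natl.
by rewrite normrM ler_pM// entry_le_norm.
Qed.

Lemma mx_norm_tr m n (A : 'M[R]_(m, n)) : `|A^T| = `|A|.
Proof.
apply/eqP; rewrite eq_le; apply/andP; split.
  by apply: mx_norm_le => // i j; rewrite mxE entry_le_norm.
by apply: mx_norm_le => // i j; rewrite (le_trans _ (entry_le_norm A^T j i))// mxE.
Qed.

Lemma mx_norm_mulB1 n (A B : 'M[R]_n) a b :
  `|A - 1%:M| <= a -> `|B - 1%:M| <= b ->
  `|A *m B - 1%:M| <= a + b + n%:R * (a * b).
Proof.
move=> Aa Bb.
have -> : A *m B - 1%:M = (A - 1%:M) + (B - 1%:M) + (A - 1%:M) *m (B - 1%:M).
  rewrite mulmxBl mulmxBr mulmx1 mul1mx.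
  move: (A *m B) => C; apply/matrixP => i j; rewrite !mxE; ring.
rewrite (le_trans (ler_normD _ _))// lerD//.
  by rewrite (le_trans (ler_normD _ _))// lerD.
rewrite (le_trans (mx_norm_mul _ _))// ler_wpM2l//.
by rewrite ler_pM.
Qed.

(** This trace is the squared Frobenius norm, compared with the maximum norm below. *)
Lemma mxtrace_mul_tr m n (A : 'M[R]_(m, n)) :
  \tr (A *m A^T) = \sum_i \sum_j A i j ^+ 2.
Proof.
rewrite /mxtrace; apply: eq_bigr => i _; rewrite mxE.
by apply: eq_bigr => j _; rewrite mxE expr2.
Qed.

Lemma mxtrace_mul_tr_ge0 m n (A : 'M[R]_(m, n)) : 0 <= \tr (A *m A^T).
Proof.
by rewrite mxtrace_mul_tr; apply: sumr_ge0 => i _; apply: sumr_ge0 => j _;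
  exact: sqr_ge0.
Qed.

Lemma mx_norm_sqr_le m n (A : 'M[R]_(m, n)) : `|A| ^+ 2 <= \tr (A *m A^T).
Proof.
rewrite -(@ler_sqrt R) ?mxtrace_mul_tr_ge0// sqrtr_sqr normr_id.
apply: mx_norm_le => [|i j]; first exact: sqrtr_ge0.
rewrite -sqrtr_sqr ler_sqrt ?mxtrace_mul_tr_ge0// mxtrace_mul_tr.
rewrite (bigD1 i)//= (bigD1 j)//= -addrA lerDl addr_ge0//.
  by apply: sumr_ge0 => k _; exact: sqr_ge0.
by apply: sumr_ge0 => k _; apply: sumr_ge0 => l _; exact: sqr_ge0.
Qed.

Lemma mxtrace_mul_tr_le n (A : 'M[R]_n) :
  \tr (A *m A^T) <= (n%:R * `|A|) ^+ 2.
Proof.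
rewrite mxtrace_mul_tr (@le_trans _ _ (\sum_(i < n) \sum_(j < n) `|A| ^+ 2))//.
  apply: ler_sum => i _; apply: ler_sum => j _.
  by rewrite -real_normK ?num_real// lerXn2r ?nnegrE// entry_le_norm.
by rewrite !sumr_const !card_ord -mulrnA -[leLHS]mulr_natl exprMn natrM expr2.
Qed.

(** A matrix close to the identity is positive definite as a quadratic form, so
    the sum over the rows v of b of v W v^T can only be nonpositive if b is zero. *)
Lemma quad_form_gt0 n (W b : 'M[R]_n) e :
  `|W - 1%:M| <= e -> n%:R * e < 1 -> \tr (b *m W *m b^T) <= 0 -> b = 0.
Proof.
move=> We ne1 tr0.
have e0 : 0 <= e by exact: le_trans We.
set E := W - 1%:M in We.
have WE : W = 1%:M + E by rewrite /E addrC subrK.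
have key : - \tr (b *m E *m b^T) <= n%:R * e * \tr (b *m b^T).
  rewrite -raddfN/= -mulNmx.
  have -> : \tr (- (b *m E) *m b^T) =
      \sum_i \sum_k \sum_j (- (b i j * E j k * b i k)).
    apply: eq_bigr => i _; rewrite mxE; apply: eq_bigr => k _.
    rewrite !mxE -sumrN big_distrl/=; apply: eq_bigr => j _.
    by rewrite mulNr.
  apply: (@le_trans _ _ (\sum_(i < n) \sum_(k < n) \sum_(j < n)
     (2^-1 * e * (b i j ^+ 2 + b i k ^+ 2)))).
    apply: ler_sum => i _; apply: ler_sum => k _; apply: ler_sum => j _.
    apply: (le_trans (ler_norm _)); rewrite normrN !normrM.
    have h1 : `|E j k| <= e by exact: le_trans (entry_le_norm _ _ _) We.
    have h2 : `|b i j| * `|b i k| <= 2^-1 * (b i j ^+ 2 + b i k ^+ 2).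
      rewrite -(real_normK (num_real (b i j))) -(real_normK (num_real (b i k))).
      have := sqr_ge0 (`|b i j| - `|b i k|); nra.
    rewrite mulrAC (le_trans (ler_pM _ _ h2 h1))//.
    by rewrite mulrAC.
  rewrite mxtrace_mul_tr mulr_sumr; apply: ler_sum => i _.
  set S := \sum_j b i j ^+ 2.
  have -> : \sum_(k < n) \sum_(j < n) 2^-1 * e * (b i j ^+ 2 + b i k ^+ 2) =
      \sum_(k < n) 2^-1 * e * (S + n%:R * b i k ^+ 2).
    apply: eq_bigr => k _; rewrite -mulr_sumr big_split/=; congr (_ * (_ + _)).
    by rewrite sumr_const card_ord mulr_natl.
  rewrite -mulr_sumr big_split/= sumr_const card_ord -mulr_sumr -/S -mulr_natl.
  by rewrite le_eqVlt; apply/orP; left; apply/eqP; field.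
have : \tr (b *m b^T) = 0.
  apply/eqP; rewrite eq_le mxtrace_mul_tr_ge0 andbT.
  move: tr0; rewrite WE mulmxDr mulmx1 mulmxDl mxtraceD => tr0.
  move: (mxtrace_mul_tr_ge0 b) tr0 key ne1; set t := \tr (b *m b^T).
  set s := \tr (b *m E *m b^T); set d := n%:R * e => t0 st sd d1.
  have h : (1 - d) * t <= 0 by lra.
  rewrite leNgt; apply/negP => t1.
  have : 0 < (1 - d) * t by rewrite mulr_gt0// subr_gt0.
  by rewrite ltNge h.
move=> b0; apply/eqP; rewrite -normr_eq0 -sqrf_eq0 eq_le sqr_ge0 andbT.
by rewrite -b0 mx_norm_sqr_le.
Qed.

End MatrixNorm.

(** * Square roots of matrices near the identity *)

(* Matrices are complete and normed; joining the two structures makes the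
   contraction principle applicable to them. *)
HB.instance Definition _ (R : realType) m n :=
  Uniform_isComplete.Build 'M[R]_(m, n) (@mx_complete R m n).

Section SquareRoot.
Variable R : realType.
Variable n : nat.
Implicit Types h s t : 'M[R]_n.

Lemma closed_norm_le (V : normedModType R) (r : R) : closed [set u : V | `|u| <= r].
Proof.
rewrite (_ : mkset _ = (fun u : V => `|u|) @^-1` [set x | x <= r])//.
apply: (proj1 (continuous_closedP _)); last exact: closed_le.
exact: norm_continuous.
Qed.

(** Writing s = 1 + u, the equation s^2 = h becomes u = (h - 1 - u^2) / 2, whose
    right-hand side is a contraction of the ball of radius r. *)
Lemma sqrtmx_near1 h r : 0 <= r -> n%:R * r < 1 -> `|h - 1%:M| <= r ->
  exists2 s, s *m s = h & `|s - 1%:M| <= r.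
Proof.
move=> r0 nr1 hr.
pose U := [set u : 'M[R]_n | `|u| <= r].
pose f (u : 'M[R]_n) := 2^-1 *: (h - 1%:M - u *m u).
have fU : set_fun U U f.
  move=> u; rewrite /U/= => ur; rewrite /f normrZ ger0_norm ?invr_ge0//.
  rewrite ler_pdivrMl// (le_trans (ler_normB _ _))//.
  rewrite mulrDl !mul1r lerD// (le_trans (mx_norm_mul _ _))//.
  rewrite (@le_trans _ _ (n%:R * (r * r)))//.
    by rewrite ler_wpM2l// ler_pM.
  by rewrite mulrA -[leRHS]mul1r ler_wpM2r// ltW.
have nr0 : 0 <= n%:R * r by rewrite mulr_ge0.
have ctr : is_contraction (mkfun fU).
  exists (NngNum nr0); split=> //=.
  move=> [u v]/= [ur vr]; rewrite /f -scalerBr normrZ ger0_norm ?invr_ge0//.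
  rewrite ler_pdivrMl//.
  have -> : h - 1%:M - u *m u - (h - 1%:M - v *m v) =
      - (u *m (u - v) + (u - v) *m v).
    rewrite mulmxBr mulmxBl addrA subrK.
    by move: (u *m u) (v *m v) => C D; apply/matrixP => i j; rewrite !mxE; ring.
  rewrite normrN (le_trans (ler_normD _ _))//.
  rewrite (_ : 2 * _ = n%:R * (r * `|u - v|) + n%:R * (`|u - v| * r)); last by ring.
  by rewrite lerD// (le_trans (mx_norm_mul _ _))// ler_wpM2l// ler_pM.
have [u ur uE] : exists2 u : 'M[R]_n, U u & u = f u.
  apply: (banach_fixed_point ctr); first exact: closed_norm_le.
  by exists 0; rewrite /U/= normr0.
exists ((1%:M : 'M[R]_n) + u); last by rewrite addrC addKr.
rewrite mulmxDl mul1mx mulmxDr mulmx1.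
have : (2 : R) *: u = h - 1%:M - u *m u.
  by rewrite {1}uE /f scalerA mulfV ?scale1r// pnatr_eq0.
move/matrixP => E; apply/matrixP => i j; have := E i j.
rewrite !mxE => Eij; lra.
Qed.

(** With a = s - 1 and b = t - 1, equality of the squares reads
    2 (s - t) = - a (s - t) - (s - t) b, where the right-hand side is too small
    unless s = t. *)
Lemma sqrtmx_unique s t r : 0 <= r -> n%:R * r < 1 ->
  `|s - 1%:M| <= r -> `|t - 1%:M| <= r -> s *m s = t *m t -> s = t.
Proof.
move=> r0 nr1 sr tr st; set a := s - 1%:M in sr; set b := t - 1%:M in tr.
have E : 2 *: (s - t) = - (a *m (s - t) + (s - t) *m b).
  rewrite /a /b [(s - 1%:M) *m _]mulmxBl [_ *m (t - 1%:M)]mulmxBr mulmx1 mul1mx.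
  rewrite [s *m _]mulmxBr [(s - t) *m t]mulmxBl st.
  move: (s *m t) (t *m t) => C D; apply/matrixP => i j; rewrite !mxE; ring.
apply/eqP; rewrite -subr_eq0 -normr_eq0 eq_le normr_ge0 andbT.
have : 2 * `|s - t| <= 2 * (n%:R * r * `|s - t|).
  rewrite -[X in X * _](@ger0_norm R 2)// -normrZ E normrN.
  rewrite (le_trans (ler_normD _ _))//.
  rewrite (_ : 2 * _ = n%:R * (r * `|s - t|) + n%:R * (`|s - t| * r)); last by ring.
  by rewrite lerD// (le_trans (mx_norm_mul _ _))// ler_wpM2l// ler_pM.
move=> H; have : 0 <= (n%:R * r - 1) * `|s - t| by nra.
by rewrite nmulr_rge0// subr_lt0.
Qed.

(** Both s and s^T h are square roots of h near the identity, because s^T is a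
    square root of h^T, the inverse of h.  Hence s = s^T h = s^T s s, and s is
    invertible. *)
Lemma sqrtmx_orthogonal h s r : 0 <= r -> 3 * (n%:R * r) < 1 ->
  `|h - 1%:M| <= r -> `|s - 1%:M| <= r -> s *m s = h -> h *m h^T = 1%:M ->
  s *m s^T = 1%:M.
Proof.
move=> r0 nr hr sr sh hh.
have hh' : h^T *m h = 1%:M by exact: mulmx1C.
have nr0 : 0 <= n%:R * r by rewrite mulr_ge0.
set t := s^T.
have th : t *m t = h^T by rewrite -trmx_mul sh.
have tr : `|t - 1%:M| <= r.
  by rewrite -[1%:M]tr_scalar_mx -raddfB/= mx_norm_tr.
have comm : h *m t = t *m h.
  have c1 : h^T *m t = t *m h^T by rewrite -th mulmxA.
  by rewrite -[LHS]mulmx1 -hh' mulmxA -[h *m t *m h^T]mulmxA -c1 mulmxA hh mul1mx.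
have sth : s = t *m h.
  apply: (@sqrtmx_unique _ _ (3 * r)).
  - by rewrite mulr_ge0.
  - by rewrite mulrCA.
  - by rewrite (le_trans sr)//; lra.
  - rewrite (le_trans (mx_norm_mulB1 tr hr))//.
    have : n%:R * (r * r) <= r by rewrite mulrA -[leRHS]mul1r ler_wpM2r//; lra.
    lra.
  rewrite sh mulmxA -[t *m h *m t]mulmxA comm mulmxA th.
  by rewrite hh' mul1mx.
have : s *m s *m h^T = 1%:M by rewrite sh.
rewrite {2}sth => H.
by rewrite -[RHS]H -!mulmxA hh mulmx1.
Qed.

End SquareRoot.

(** * Orthogonal matrices preserving a bilinear product *)

Section Bilinear.
Variables (R : realType) (n : nat).
Local Notation V := 'rV[R]_n.

Definition bilinear_op (B : V -> V -> V) :=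
  (forall v, linear (B^~ v)) /\ (forall u, linear (B u)).

Lemma linear_rVE (f : V -> V) : linear f ->
  forall x, f x = \sum_i x 0 i *: f (delta_mx 0 i).
Proof.
move=> lf x; pose F : {linear V -> V} := HB.pack f (GRing.isLinear.Build _ _ _ _ f lf).
have FE : f =1 F by [].
rewrite {1}[x]row_sum_delta FE linear_sum.
by apply: eq_bigr => i _; exact: (linearZ_LR F).
Qed.

Lemma linear_funD (f : V -> V) : linear f -> forall x y, f (x + y) = f x + f y.
Proof. by move=> lf x y; have := lf 1 x y; rewrite !scale1r. Qed.

Lemma linear_norm_le (f : V -> V) c : linear f -> 0 <= c ->
  (forall i, `|f (delta_mx 0 i)| <= c) -> forall x, `|f x| <= n%:R * (`|x| * c).
Proof.
move=> lf c0 fc x; rewrite (linear_rVE lf) (le_trans (ler_norm_sum _ _ _))//.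
rewrite [leRHS](_ : _ = \sum_(k < n) `|x| * c); last first.
  by rewrite sumr_const card_ord mulr_natl.
by apply: ler_sum => i _; rewrite normrZ ler_pM// entry_le_norm.
Qed.

Lemma norm_delta_mul (a : 'M[R]_n) i : `|delta_mx 0 i *m a : V| <= `|a|.
Proof.
by rewrite -rowE; apply: mx_norm_le => // k j; rewrite mxE entry_le_norm.
Qed.

(** Orthogonal automorphisms of the (not necessarily associative) algebra with
    product B, acting on row vectors from the right. *)
Definition isometries (B : V -> V -> V) : set 'M[R]_n :=
  [set x | x *m x^T = 1%:M /\ forall u v, B (u *m x) (v *m x) = B u v *m x].

Section Group.
Variable B : V -> V -> V.

Lemma isometries1 : isometries B 1%:M.
Proof. by split=> [|u v]; rewrite ?trmx1 !mulmx1. Qed.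

Lemma isometriesM x y : isometries B x -> isometries B y -> isometries B (x *m y).
Proof.
move=> [xo xB] [yo yB]; split=> [|u v].
  by rewrite trmx_mul mulmxA -[x *m y *m _]mulmxA yo mulmx1.
by rewrite !mulmxA yB xB.
Qed.

Lemma isometriesK x : isometries B x -> x^T *m x = 1%:M.
Proof. by move=> [/mulmx1C]. Qed.

Lemma isometriesV x : isometries B x -> isometries B x^T.
Proof.
move=> Bx; have := isometriesK Bx; case: Bx => [xo xB] xK.
split=> [|u v]; first by rewrite trmxK.
by rewrite -[LHS]mulmx1 -xo mulmxA -xB -!mulmxA xK !mulmx1.
Qed.

Lemma isometries_norm_le x : isometries B x -> `|x| <= 1.
Proof.
move=> [xo _]; apply: mx_norm_le => // i j.
have : (x *m x^T) i i = 1 by rewrite xo mxE eqxx.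
rewrite mxE (bigD1 j)//= mxE => H.
have : `|x i j| ^+ 2 <= 1.
  rewrite real_normK ?num_real// expr2 -H lerDl; apply: sumr_ge0 => k _.
  by rewrite mxE -expr2 sqr_ge0.
by rewrite expr_le1.
Qed.

(** The defect D(u, v) = B(u s, v s) - B(u, v) s changes sign under s:
    D(u s, v s) = - D(u, v) s.  Expanding s = 1 + a gives 2 D as a combination of
    terms that each contain a, so the largest coefficient K of D satisfies
    2 K <= (3 t + t^2) K with t = n r < 1/4, and K = 0. *)
Lemma sqrtmx_preserves (Bbil : bilinear_op B) s r : 
  `|s - 1%:M| <= r -> 4 * (n%:R * r) < 1 ->
  (forall u v, B (u *m (s *m s)) (v *m (s *m s)) = B u v *m (s *m s)) ->
  forall u v, B (u *m s) (v *m s) = B u v *m s.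
Proof.
move=> sr nr sB; set a := s - 1%:M in sr.
have r0 : 0 <= r by apply: le_trans sr.
have sE : s = 1%:M + a by rewrite /a addrC subrK.
case: Bbil => Bl Br.
pose D u v := B (u *m s) (v *m s) - B u v *m s.
have Dl v : linear (D^~ v).
  move=> c x y; rewrite /D mulmxDl -scalemxAl Bl Bl mulmxDl -scalemxAl.
  by rewrite scalerBr opprD addrACA.
have Dr u : linear (D u).
  move=> c x y; rewrite /D mulmxDl -scalemxAl Br Br mulmxDl -scalemxAl.
  by rewrite scalerBr opprD addrACA.
have DN u v : D (u *m s) (v *m s) = - (D u v *m s).
  by rewrite /D mulmxBl opprB -!mulmxA sB.
pose K := \big[Order.max/0]_(ij : 'I_n * 'I_n)
   `|D (delta_mx 0 ij.1) (delta_mx 0 ij.2)|.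
have K0 : 0 <= K by rewrite /K; elim/big_ind : _ => // x y x0 y0; rewrite le_max x0.
have DK i j : `|D (delta_mx 0 i) (delta_mx 0 j)| <= K.
  exact: (le_bigmax _ (fun ij : 'I_n * 'I_n => `|D (delta_mx 0 ij.1) (delta_mx 0 ij.2)|) (i, j)).
set t := n%:R * r in nr.
have t0 : 0 <= t by rewrite mulr_ge0.
have step (f : V -> V) c j : linear f -> 0 <= c ->
    (forall i, `|f (delta_mx 0 i)| <= c) -> `|f (delta_mx 0 j *m a)| <= t * c.
  move=> lf c0 fc; rewrite (le_trans (linear_norm_le lf c0 fc _))//.
  rewrite /t -mulrA ler_wpM2l// ler_wpM2r//.
  exact: le_trans (norm_delta_mul _ _) sr.
have D2 i j : 2 * `|D (delta_mx 0 i) (delta_mx 0 j)| <= (3 * t + t ^+ 2) * K.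
  set ei := delta_mx 0 i; set ej := delta_mx 0 j.
  have E : D ei ej *+ 2 =
     - (D ei (ej *m a) + D (ei *m a) ej + D (ei *m a) (ej *m a) + D ei ej *m a).
    have := DN ei ej; rewrite {1 2 3}sE !mulmxDr !mulmx1.
    rewrite (linear_funD (Dl _)) !(linear_funD (Dr _)) => H.
    rewrite mulr2n; move: H.
    move: (D ei (ej *m a)) (D (ei *m a) ej) (D (ei *m a) (ej *m a)).
    move=> X Y Z H; apply/eqP; rewrite -subr_eq0; apply/eqP.
    move/eqP: H; rewrite -subr_eq0 => /eqP <-.
    by apply/rowP => k; rewrite !mxE; ring.
  rewrite mulr_natl -normrMn E normrN.
  apply: (le_trans (ler_normD _ _)).
  rewrite (_ : _ * K = t * K + t * K + t * (t * K) + t * K); last by ring.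
  apply: lerD; last first.
    rewrite (le_trans (mx_norm_mul _ _))// /t -mulrA ler_wpM2l//.
    by rewrite mulrC ler_pM// DK.
  apply: (le_trans (ler_normD _ _)); apply: lerD; last first.
    exact: (step (D^~ (ej *m a)) (t * K) i (Dl _) (mulr_ge0 t0 K0)
      (fun k => step (D (delta_mx 0 k)) K j (Dr _) K0 (DK k))).
  apply: (le_trans (ler_normD _ _)); apply: lerD.
    exact: (step (D ei) K j (Dr ei) K0 (DK i)).
  exact: (step (D^~ ej) K i (Dl ej) K0 (DK^~ j)).
have K2 : 2 * K <= (3 * t + t ^+ 2) * K.
  rewrite mulrC -ler_pdivlMr// /K; apply: bigmax_le => [|[i j] _ /=].
    by rewrite mulr_ge0// mulr_ge0// addr_ge0// ?mulr_ge0// exprn_ge0.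
  by rewrite ler_pdivlMr// mulrC D2.
have t1 : 3 * t + t ^+ 2 <= 1 by rewrite expr2; nra.
have KE : K = 0 by have := ler_wpM2r K0 t1; lra.
have De i j : D (delta_mx 0 i) (delta_mx 0 j) = 0.
  by apply/eqP; rewrite -normr_eq0 eq_le normr_ge0 -KE DK.
move=> u v; apply/eqP; rewrite -subr_eq0 -/(D u v); apply/eqP.
rewrite (linear_rVE (Dl v)) big1// => i _; rewrite (linear_rVE (Dr _)) big1 ?scaler0// => j _.
by rewrite De scaler0.
Qed.

(** This is what makes small steps inside the isometry group divisible by two;
    it replaces the exponential map. *)
Lemma isometries_sqrt (Bbil : bilinear_op B) h r :
  isometries B h -> `|h - 1%:M| <= r -> 4 * (n%:R * r) < 1 ->
  exists s, [/\ isometries B s, s *m s = h & `|s - 1%:M| <= r].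
Proof.
move=> [ho hB] hr nr; have r0 : 0 <= r by apply: le_trans hr.
have t0 : 0 <= n%:R * r by rewrite mulr_ge0.
have [|s sh sr] := sqrtmx_near1 r0 _ hr; first by lra.
exists s; split=> //; split.
  by apply: (@sqrtmx_orthogonal _ _ h s r) => //; lra.
by apply: (sqrtmx_preserves Bbil sr) => // u v; rewrite sh.
Qed.

(** Let s be the square root of h = x^T y.  Then
    2 (x s) - x - y = x s (1 - s)^T (1 - s), whose pairing with A is the value of
    the quadratic form of A^T x s on the rows of 1 - s.  This matrix is near
    the identity, so the value is positive unless s = 1, while maximality of x
    makes it nonpositive. *)
Lemma maximizer_unique (Bbil : bilinear_op B) (A x y : 'M[R]_n) r :
  8 * (n.+1%:R * r) <= 1 ->
  `|A - 1%:M| <= r -> `|x - 1%:M| <= r -> `|x - y| * n%:R <= r ->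
  isometries B x -> isometries B y ->
  (forall z, isometries B z -> \tr (A^T *m z) <= \tr (A^T *m x)) ->
  \tr (A^T *m x) <= \tr (A^T *m y) -> x = y.
Proof.
move=> nr Ar xr xyr Bx By xmax xy.
have r0 : 0 <= r by apply: le_trans Ar.
have [t0 nr'] : 0 <= n%:R * r /\ 8 * (n%:R * r) <= 1.
  have : 0 <= n%:R * r by rewrite mulr_ge0.
  by move: nr; rewrite -natr1 mulrDl mul1r; lra.
set t := n%:R * r in t0 nr'.
set h := x^T *m y.
have Bh : isometries B h by apply: isometriesM => //; exact: isometriesV.
have xh : x *m h = y by rewrite /h mulmxA; case: Bx => -> _; rewrite mul1mx.
have hr : `|h - 1%:M| <= r.
  rewrite /h -(isometriesK Bx) -mulmxBr (le_trans (mx_norm_mul _ _))//.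
  rewrite (le_trans _ xyr)// mulrC ler_wpM2r// distrC -[leRHS]mul1r ler_wpM2r//.
  by rewrite mx_norm_tr (isometries_norm_le Bx).
have [|s [Bs sh sr]] := isometries_sqrt Bbil Bh hr; first by lra.
set b := 1%:M - s^T.
have so := proj1 Bs.
have bT : b^T = 1%:M - s by rewrite /b linearB/= trmx1 trmxK.
have F : s *m b *m b^T = s *+ 2 - 1%:M - s *m s.
  rewrite bT /b [s *m (1%:M - s^T)]mulmxBr mulmx1 so mulmxBl mulmxBr mulmx1 mul1mx.
  by move: (s *m s) => C; apply/matrixP => i j; rewrite !mxE; ring.
have E : 2 *: (x *m s) - x - y = x *m s *m b *m b^T.
  rewrite -!mulmxA (mulmxA s) F -xh -sh !mulmxBr mulmx1 scaler_nat.
  by rewrite [x *m (s *+ 2)]raddfMn.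
have tr_le : \tr (b^T *m (A^T *m x *m s) *m b^T^T) <= 0.
  rewrite trmxK mxtrace_mulC !mulmxA.
  have -> : b *m b^T *m A^T *m x *m s = b *m b^T *m (A^T *m (x *m s)) by rewrite !mulmxA.
  rewrite mxtrace_mulC -mulmxA (mulmxA (x *m s)) -E mulmxBr mulmxBr linearB/= linearB/=.
  rewrite -scalemxAr mxtraceZ.
  by have := xmax _ (isometriesM Bx Bs); lra.
have n0 : 0 <= n%:R :> R by [].
have rr : n%:R * (r * r) <= 8^-1 * r.
  by rewrite mulrA ler_wpM2r// -/t; lra.
(* Three factors within r of the identity; the products of the errors are
   absorbed in the fourth r. *)
have W : `|A^T *m x *m s - 1%:M| <= 4 * r.
  have Atr : `|A^T - 1%:M| <= r by rewrite -trmx1 -raddfB/= mx_norm_tr.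
  have := mx_norm_mulB1 (mx_norm_mulB1 Atr xr) sr => /le_trans; apply.
  have : n%:R * ((r + r + n%:R * (r * r)) * r) <= n%:R * (3 * r * r).
    by rewrite ler_wpM2l// ler_wpM2r//; lra.
  lra.
have b0 : b^T = 0.
  apply: (quad_form_gt0 W) => //; rewrite mulrCA -/t; lra.
have s1 : s = 1%:M.
  move: b0; rewrite /b linearB/= trmx1 trmxK => /eqP.
  by rewrite subr_eq0 eq_sym => /eqP.
by rewrite -xh -sh s1 !mulmx1.
Qed.

End Group.
End Bilinear.

(** * Compactness and rigidity of finite groups of isometries *)

Section Compactness.
Variable R : realType.

Lemma bounded_linear_map_continuous (V W : normedModType R) (f : {linear V -> W}) (C : R) :
  (forall x, `|f x| <= C * `|x|) -> continuous f.
Proof.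
move=> fC; apply: bounded_linear_continuous; apply/linear_boundedP.
apply: filterS (nbhs_pinfty_ge (num_real C)) => r Cr x.
by rewrite (le_trans (fC x))// ler_wpM2r.
Qed.

Lemma bounded_closed_compact_mx m n (A : set 'M[R]_(m, n)) (C : R) :
  (forall x, A x -> `|x| <= C) -> closed A -> compact A.
Proof.
move=> AC clA.
have cv : continuous (vec_mx : 'rV[R]_(m * n) -> 'M[R]_(m, n)).
  apply: (@bounded_linear_map_continuous _ _ _ 1) => x; rewrite mul1r.
  by apply: mx_norm_le => // i j; rewrite mxE entry_le_norm.
pose A' := vec_mx @^-1` A : set 'rV[R]_(m * n).
have -> : A = vec_mx @` A'.
  apply/seteqP; split=> [x Ax|_ [v Av <-]]//.
  by exists (mxvec x); rewrite /A' /= ?mxvecK.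
apply: continuous_compact; first exact: continuous_subspaceT.
apply: bounded_closed_compact.
  exists C; split; first exact: num_real.
  move=> M CM v /AC vC /=; rewrite (le_trans _ (ltW CM))// (le_trans _ vC)//.
  apply: mx_norm_le => // i j; rewrite ord1 -{1}(vec_mxK v).
  by case/mxvec_indexP: j => k l; rewrite mxvecE entry_le_norm.
by apply: (proj1 (continuous_closedP _)).
Qed.

Definition entries_continuous (T : topologicalType) m n (F : T -> 'M[R]_(m, n)) :=
  forall i j, continuous (fun x => F x i j).

Lemma continuous_sum (T : topologicalType) (I : Type) (r : seq I) (P : pred I)
  (F : I -> T -> R) : (forall i, P i -> continuous (F i)) ->
  continuous (fun x => \sum_(i <- r | P i) F i x).
Proof. by apply: continuous_big => x; exact: add_continuous. Qed.

Lemma continuous_prod (T : topologicalType) (f g : T -> R) :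
  continuous f -> continuous g -> continuous (fun x => f x * g x).
Proof. by move=> cf cg x; apply: cvgM; [exact: cf|exact: cg]. Qed.

Lemma entries_continuous_mul (T : topologicalType) m n p
    (F : T -> 'M[R]_(m, n)) (G : T -> 'M[R]_(n, p)) :
  entries_continuous F -> entries_continuous G ->
  entries_continuous (fun x => F x *m G x).
Proof.
move=> cF cG i j; rewrite (_ : (fun x => _) =
    (fun x => \sum_k F x i k * G x k j)); last by apply/funext => x; rewrite mxE.
by apply: continuous_sum => k _; apply: continuous_prod; [exact: cF|exact: cG].
Qed.

(** Continuity is required entry by entry, which is how products and sums of
    matrices are seen to be continuous here. *)
Lemma closed_eq_entries (T : topologicalType) m n (F G : T -> 'M[R]_(m, n)) :
  entries_continuous F -> entries_continuous G -> closed [set x | F x = G x].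
Proof.
move=> cF cG.
rewrite (_ : mkset _ =
  \bigcap_(ij in [set: 'I_m * 'I_n]) (fun x => F x ij.1 ij.2 - G x ij.1 ij.2) @^-1` [set x | x = 0]).
  apply: closed_bigI => -[i j] _; apply: (proj1 (continuous_closedP _)).
    by move=> x; apply: cvgB; [exact: cF|exact: cG].
  exact: closed_eq.
apply/seteqP; split=> x /=.
  by move=> E [i j] _ /=; rewrite E subrr.
move=> E; apply/matrixP => i j; apply/eqP; rewrite -subr_eq0; apply/eqP.
exact: (E (i, j)).
Qed.

Variable n : nat.
Local Notation V := 'rV[R]_n.
Variable B : V -> V -> V.
Hypothesis Bbil : bilinear_op B.

Lemma isometries_compact : compact (isometries B).
Proof.
have ec : entries_continuous (@id 'M[R]_n) by move=> i j; exact: coord_continuous.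
have ecst m p (c : 'M[R]_(m, p)) : entries_continuous (fun _ : 'M[R]_n => c).
  by move=> i j; exact: cst_continuous.
apply: (bounded_closed_compact_mx (C := 1)).
  by move=> x Bx; exact: isometries_norm_le Bx.
rewrite (_ : isometries B = [set x | x *m x^T = 1%:M] `&`
   \bigcap_(uv in [set: V * V])
     [set x | B (uv.1 *m x) (uv.2 *m x) = B uv.1 uv.2 *m x]); last first.
  apply/seteqP; split=> x [xo xB]; split=> //.
  - by move=> [u v] _; exact: xB.
  - by move=> u v; exact: (xB (u, v)).
apply: closedI.
  apply: closed_eq_entries => //; apply: entries_continuous_mul => // i j.
  rewrite (_ : (fun _ => _) = fun x : 'M[R]_n => x j i); last first.
    by apply/funext => x; rewrite mxE.
  exact: coord_continuous.
apply: closed_bigI => -[u v] _ /=; apply: closed_eq_entries; last first.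
  exact: entries_continuous_mul.
have [Bl Br] := Bbil.
move=> i j; rewrite ord1 {i}.
rewrite (_ : (fun x => _) = fun x : 'M[R]_n => \sum_k \sum_l
   (u *m x) 0 k * (v *m x) 0 l * B (delta_mx 0 k) (delta_mx 0 l) 0 j).
  apply: continuous_sum => k _; apply: continuous_sum => l _.
  apply: continuous_prod; last exact: cst_continuous.
  by apply: continuous_prod; apply: (@entries_continuous_mul _ 1 n n (fun=> _) id).
apply/funext => x; rewrite (linear_rVE (Bl _)) summxE; apply: eq_bigr => k _.
rewrite (linear_rVE (Br _)) [LHS]mxE summxE mulr_sumr; apply: eq_bigr => l _.
by rewrite [X in _ * X]mxE mulrA.
Qed.

Lemma maximizer_exists (A : 'M[R]_n) :
  exists2 x, isometries B x &
    forall z, isometries B z -> \tr (A^T *m z) <= \tr (A^T *m x).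
Proof.
have [||x] := @compact_EVT_max _ R (fun z => \tr (A^T *m z)) _ _ isometries_compact.
- by exists 1%:M; exact: isometries1.
- apply: continuous_subspaceT; apply: continuous_sum => i _.
  apply: (@entries_continuous_mul _ n n n (fun=> _) id) => k l.
    exact: cst_continuous.
  exact: coord_continuous.
rewrite inE => Bx xmax; exists x => // z Bz.
by apply: xmax; rewrite inE.
Qed.

(** The average A of r'(i)^T r(i) is close to the identity and satisfies
    r'(j)^T A r(j) = A.  Its unique nearest isometry x is therefore fixed by
    x |-> r'(j) x r(j)^T.  Right cancellation
    in the group makes i |-> mul i j a reindexing of the sum defining A. *)
Lemma isometries_rigid : exists2 delta : R, 0 < delta &
  forall (I : finType) (i0 : I) (mul : I -> I -> I) (r r' : I -> 'M[R]_n),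
    (forall j, injective (mul^~ j)) ->
    (forall i, isometries B (r i)) -> (forall i, isometries B (r' i)) ->
    (forall i j, r (mul i j) = r i *m r j) ->
    (forall i j, r' (mul i j) = r' i *m r' j) ->
    (forall i, `|r i - r' i| <= delta) ->
  exists2 x, isometries B x & forall i, r' i *m x = x *m r i.
Proof.
pose c : R := n.+1%:R.
have c1 : 1 <= c by rewrite /c ler1n.
have nc : n%:R + 1 = c by rewrite /c -natr1.
have c0 : 0 < c by apply: lt_le_trans c1.
pose rad := (8 * c)^-1.
have rad0 : 0 < rad by rewrite invr_gt0 mulr_gt0.
(* rad is the radius within which maximizers are unique.  If A is within eta of
   the identity, its maximizers are within rad of it. *)
pose eta := rad / (2 * c ^+ 2).
have eta0 : 0 < eta by rewrite divr_gt0// mulr_gt0// exprn_gt0.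
have etaE : 2 * (c * (c * eta)) = rad.
  by rewrite /eta; field; rewrite gt_eqF.
have n0 : 0 <= n%:R :> R by [].
exists (eta / c); first exact: divr_gt0.
move=> I i0 mul r r' mulI Br Br' rM r'M rr'.
have q0 : (0 : R) < #|I|%:R by rewrite ltr0n; apply/card_gt0P; exists i0.
pose A := #|I|%:R^-1 *: \sum_i (r' i)^T *m r i.
have A1 : `|A - 1%:M| <= eta.
  have -> : A - 1%:M = #|I|%:R^-1 *: \sum_i ((r' i)^T *m (r i - r' i)).
    rewrite (eq_bigr (fun i => (r' i)^T *m r i - 1%:M)); last first.
      by move=> i _; rewrite mulmxBr (isometriesK (Br' i)).
    rewrite big_split/= scalerDr sumrN scalerN sumr_const.
    by rewrite -[X in _ - _ *: X]scaler_nat scalerA mulVf ?scale1r// gt_eqF.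
  rewrite normrZ gtr0_norm ?invr_gt0// ler_pdivrMl//.
  rewrite (le_trans (ler_norm_sum _ _ _))// mulr_natl -sumr_const ler_sum// => i _.
  rewrite (le_trans (mx_norm_mul _ _))//.
  have h1 : `|(r' i)^T| * `|r i - r' i| <= 1 * (eta / c).
    by rewrite ler_pM// mx_norm_tr (isometries_norm_le (Br' i)).
  rewrite (le_trans (ler_wpM2l n0 h1))// mul1r mulrA ler_pdivrMr// mulrC ler_pM2l//.
  by rewrite -nc; lra.
have Aj j : (r' j)^T *m A *m r j = A.
  rewrite /A -scalemxAr -scalemxAl; congr (_ *: _).
  rewrite mulmx_sumr mulmx_suml [RHS](reindex_inj (mulI j))/=.
  by apply: eq_bigr => i _; rewrite rM r'M trmx_mul !mulmxA.
have [x Bx xmax] := maximizer_exists A.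
(* On orthogonal z, |z - A|^2 is a constant minus 2 tr (A^T z), so a maximizer is
   no farther from A than the identity is. *)
have maximizer_near y : isometries B y -> \tr (A^T *m 1%:M) <= \tr (A^T *m y) ->
    `|y - A| <= n%:R * eta.
  move=> By ymax.
  have sq : \tr ((y - A) *m (y - A)^T) <= \tr ((1%:M - A) *m (1%:M - A)^T).
    have E z : isometries B z -> \tr ((z - A) *m (z - A)^T) =
        \tr (1%:M : 'M[R]_n) + \tr (A *m A^T) - 2 * \tr (A^T *m z).
      move=> Bz; rewrite linearB/= mulmxBl 2!mulmxBr (proj1 Bz).
      rewrite !mxtraceD !(raddfN (@mxtrace R n))/= mxtraceD (raddfN (@mxtrace R n))/=.
      have -> : \tr (z *m A^T) = \tr (A^T *m z) by rewrite mxtrace_mulC.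
      have -> : \tr (A *m z^T) = \tr (A^T *m z).
        by rewrite -mxtrace_tr trmx_mul trmxK mxtrace_mulC.
      by ring.
    by rewrite (E y)// (E 1%:M); [lra|exact: isometries1].
  have ne0 : 0 <= n%:R * eta by exact: mulr_ge0 n0 (ltW eta0).
  have ne1 : 0 <= n%:R * `|1%:M - A| by exact: mulr_ge0.
  rewrite -(@ler_pXn2r _ 2%N) ?nnegrE//.
  rewrite (le_trans (mx_norm_sqr_le _))// (le_trans sq)//.
  rewrite (le_trans (mxtrace_mul_tr_le _))// ler_pXn2r ?nnegrE//.
  by rewrite ler_wpM2l// distrC.
have ce : eta <= c * eta by rewrite -[leLHS]mul1r ler_pM2r.
have cce : c * eta <= c * (c * eta) by rewrite -[leLHS]mul1r ler_pM2r// mulr_gt0.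
have E1 : n%:R * eta + eta = c * eta by rewrite -nc; ring.
have xA := maximizer_near x Bx (xmax _ (isometries1 B)).
have x1 : `|x - 1%:M| <= rad.
  rewrite -(subrKA A) (le_trans (ler_normD _ _))//.
  rewrite (le_trans (lerD xA A1))//.
  have : 0 < c * eta by rewrite mulr_gt0.
  lra.
exists x => // j; set y := r' j *m x *m (r j)^T.
have By : isometries B y.
  by rewrite /y; apply: isometriesM; [exact: isometriesM|exact: isometriesV].
have yx : \tr (A^T *m y) = \tr (A^T *m x).
  by rewrite -{2}(Aj j) !trmx_mul trmxK /y !mulmxA mxtrace_mulC !mulmxA.
have yA : `|y - A| <= n%:R * eta by apply: maximizer_near => //; rewrite yx xmax//; exact: isometries1.
have -> : r' j *m x = y *m r j by rewrite /y -mulmxA (isometriesK (Br j)) mulmx1.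
congr (_ *m _); apply/esym.
have nc' : n%:R <= c by lra.
apply: (@maximizer_unique _ _ B Bbil A x y rad) => //.
- by rewrite -/c /rad invfM mulrCA (mulrA 8) mulfV// mul1r mulfV// gt_eqF.
- rewrite (le_trans A1)//; have : 0 < c * eta by rewrite mulr_gt0.
  lra.
- apply: (@le_trans _ _ (2 * (n%:R * eta) * n%:R)).
    rewrite ler_wpM2r// -(subrKA A) (le_trans (ler_normD _ _))//.
    by rewrite (distrC A); lra.
  rewrite -etaE -mulrA ler_pM2l// mulrC.
  apply: ler_pM => //; first exact: mulr_ge0 n0 (ltW eta0).
  by rewrite ler_pM2r.
- by rewrite yx.
Qed.

End Compactness.

(** * The Laplacian under an orthogonal change of coordinates *)

Section Transport.
Variable R : realType.

Lemma mulmxr_continuous m n p (A : 'M[R]_(n, p)) :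
  continuous (mulmxr A : 'M[R]_(m, n) -> 'M[R]_(m, p)).
Proof.
apply: (@bounded_linear_map_continuous _ _ _ _ (n%:R * `|A|)) => x.
by rewrite -mulrA (mulrC `|A|); exact: mx_norm_mul.
Qed.

Section Comp.
Variables (V' V W W' : normedModType R).
Variables (A : {linear V' -> V}) (L : {linear W -> W'}).
Hypotheses (cA : continuous A) (cL : continuous L).

Lemma differentiable_lin_comp (F : V -> W) x : differentiable F (A x) ->
  differentiable (fun y => L (F (A y))) x.
Proof.
move=> dF; apply: (@differentiable_comp _ _ _ _ (F \o A) L).
  by apply: differentiable_comp => //; exact: linear_differentiable.
exact: linear_differentiable.
Qed.

Lemma derive_lin_comp (F : V -> W) x v : differentiable F (A x) ->
  'D_v (fun y => L (F (A y))) x = L ('D_(A v) F (A x)).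
Proof.
move=> dF; rewrite !deriveE//; last exact: differentiable_lin_comp.
have dA := linear_differentiable x cA.
have dL := linear_differentiable (F (A x)) cL.
have dFA : differentiable (F \o A) x by exact: differentiable_comp.
rewrite (@diff_comp _ _ _ _ (F \o A) L)//= (@diff_comp _ _ _ _ A F)//=.
by rewrite !diff_lin.
Qed.

(** The derivative of L o F o A in the direction v is L o (D_(A v) F) o A, of the
    same shape, so the induction on k closes. *)
Lemma Ck_lin_comp k (F : V -> W) : Ck k F -> Ck k (fun y => L (F (A y))).
Proof.
elim: k F => [F cF x|k IH F [dF CF]].
  apply: (@continuous_comp _ _ _ (F \o A) L); last exact: cL.
  by apply: continuous_comp; [exact: cA|exact: cF].
split=> [x|v]; first exact: differentiable_lin_comp.
rewrite (_ : (fun x => _) = fun x => L ('D_(A v) F (A x))); last first.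
  by apply/funext => x; rewrite derive_lin_comp.
exact: (IH (fun y => 'D_(A v) F y) (CF (A v))).
Qed.

Lemma smooth_lin_comp (F : V -> W) : smooth F -> smooth (fun y => L (F (A y))).
Proof. by move=> sF k; exact: Ck_lin_comp. Qed.

End Comp.

Lemma dotE n (x y : 'rV[R]_n) : dot x y = (x *m y^T) 0 0.
Proof. by rewrite mxE; apply: eq_bigr => i _; rewrite mxE. Qed.

Lemma dot_mulr n (x y : 'rV[R]_n) (A : 'M[R]_n) :
  dot (x *m A) y = dot x (y *m A^T).
Proof. by rewrite !dotE trmx_mul trmxK mulmxA. Qed.

Variable n : nat.
Implicit Types (M : set 'rV[R]_n) (A : 'M[R]_n).

Lemma tangent_mul M A x v : (forall y, M y -> M (y *m A)) ->
  tangent M x v -> tangent M (x *m A) (v *m A).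
Proof.
move=> MA [c [c0 Mc dc]]; exists (mulmxr A \o c); split.
- by rewrite /= c0.
- by move=> t; apply: MA.
- have dc1 : differentiable c (0 : R) by apply/derivable1_diffP; apply: ex_derive.
  have e := @derive_lin_comp R R _ _ idfun (mulmxr A)
    (fun x => @cvg_id _ _) (@mulmxr_continuous 1 n n A) c 0 1 dc1.
  have d := @differentiable_lin_comp R R _ _ idfun (mulmxr A)
    (fun x => @cvg_id _ _) (@mulmxr_continuous 1 n n A) c 0 dc1.
  apply: DeriveDef; first by apply/derivable1_diffP.
  by rewrite [LHS]e /= derive_val.
Qed.

Section Isometry.
Variables (M : set 'rV[R]_n) (A : 'M[R]_n).
Hypotheses (Ao : A *m A^T = 1%:M) (MA : forall y, M y -> M (y *m A))
  (MAt : forall y, M y -> M (y *m A^T)).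

Let Ao' : A^T *m A = 1%:M. Proof. exact: mulmx1C. Qed.

Lemma tangent_mulE x v : tangent M x v <-> tangent M (x *m A) (v *m A).
Proof.
split; first exact: tangent_mul.
by move/(tangent_mul MAt); rewrite -!mulmxA Ao !mulmx1.
Qed.

(** Since A is orthogonal, precomposition with A turns the gradient V into
    x |-> V (x A) A^T. *)
Lemma tangential_gradient_mul (F : 'rV[R]_n -> R) V : smooth F ->
  tangential_gradient M F V ->
  tangential_gradient M (fun x => F (x *m A)) (fun x => V (x *m A) *m A^T).
Proof.
move=> sF [sV gV]; split.
  apply: (@smooth_lin_comp _ _ _ _ (mulmxr A) (mulmxr A^T)) => //; exact: mulmxr_continuous.
move=> x Mx; have [tV dV] := gV _ (MA Mx); split.
  by apply/tangent_mulE; rewrite -mulmxA Ao' mulmx1.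
move=> v tv.
have dF : differentiable F (x *m A) by case: (sF 1%N).
have := @derive_lin_comp _ _ _ _ (mulmxr A) idfun
  (@mulmxr_continuous 1 n n A) (fun x => @cvg_id _ _) F x v dF.
rewrite /= => ->; rewrite dV; last by rewrite -tangent_mulE.
by rewrite dot_mulr trmxK.
Qed.

(** An orthonormal tangent frame e at x A gives the frame e A^T at x, and the
    divergence is computed by the same sum. *)
Lemma has_divergence_mul V x r : smooth V ->
  has_divergence M V (x *m A) r ->
  has_divergence M (fun x => V (x *m A) *m A^T) x r.
Proof.
move=> sV [d [e [[eo te] ->]]]; exists d, (e *m A^T); split; [split|].
- by rewrite trmx_mul trmxK -mulmxA (mulmxA A^T) Ao' mul1mx.
- move=> v; rewrite tangent_mulE te; split.
    by move=> /(submxMr A^T); rewrite -mulmxA Ao mulmx1.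
  by move=> /(submxMr A); rewrite -mulmxA Ao' mulmx1.
apply: eq_bigr => i _; rewrite row_mul.
have dV : differentiable V (x *m A) by case: (sV 1%N).
have := @derive_lin_comp _ _ _ _ (mulmxr A) (mulmxr A^T)
  (@mulmxr_continuous 1 n n A) (@mulmxr_continuous 1 n n A^T) V x (row i e *m A^T) dV.
rewrite /= => ->.
by rewrite dot_mulr trmxK -!mulmxA Ao' !mulmx1.
Qed.

End Isometry.
End Transport.

(** * Conjugacy classes of finite groups of bounded order *)

(** The matrices rho g act on row vectors from the right, hence the reversed
    order in the multiplicativity of rho.  The groups to be conjugated are only
    seen through rho and B: conjugating matrices range over all isometries of B,
    which preserve the embedded manifold by [lm_inv]. *)
Record linear_model (R : realType) (X : gspace R)
    (B : 'rV[R]_(edim X) -> 'rV[R]_(edim X) -> 'rV[R]_(edim X))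
    (rho : elt X -> 'M[R]_(edim X)) : Prop := LinearModel {
  lm_bilinear : bilinear_op B;
  lm_isometry : forall g, grp X g -> isometries B (rho g);
  lm_mul : forall g h, grp X g -> grp X h -> rho (gmul g h) = rho h *m rho g;
  lm_pts : forall g p, grp X g -> pts X p -> pts X (act g p);
  lm_act : forall g p, grp X g -> pts X p -> emb (act g p) = emb p *m rho g;
  lm_inv : forall A x, isometries B A -> (@emb R X @` pts X) x ->
    (@emb R X @` pts X) (x *m A);
  lm_assoc : associative (@gmul R X);
  lm_unit : left_id (gone X) (@gmul R X) }.

Section Conjugation.
Variables (R : realType) (X : gspace R).
Variables (B : 'rV[R]_(edim X) -> 'rV[R]_(edim X) -> 'rV[R]_(edim X))
    (rho : elt X -> 'M[R]_(edim X)).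
Hypothesis mod : linear_model B rho.

(** If A intertwines the two groups, f |-> f o al carries eigenfunctions of the
    first group to eigenfunctions of the second, where al is the map of X given by
    right multiplication by A on the embedded points. *)
Lemma dim_eigenspace_conj (Gam1 Gam2 : {fset elt X}) A lam m :
  finite_subgroup Gam1 -> finite_subgroup Gam2 -> isometries B A ->
  (forall g', g' \in Gam2 -> exists2 g, g \in Gam1 & rho g' *m A = A *m rho g) ->
  dim_eigenspace_ge Gam1 lam m -> dim_eigenspace_ge Gam2 lam m.
Proof.
move=> [G1 _ _ _] [G2 _ _ _] BA conj [f [eigf indf]].
have Ao := proj1 BA.
pose M := @emb R X @` pts X.
have MA y : M y -> M (y *m A) by exact: (lm_inv mod).
have MAt y : M y -> M (y *m A^T) by apply: (lm_inv mod); exact: isometriesV.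
have ex p : exists q, pts X p -> pts X q /\ emb q = emb p *m A.
  have [pp|npp] := pselect (pts X p); last by exists p.
  by have [|q pq eq] := MA (emb p); [exists p|exists q].
have [al alP] := choice ex.
have eqf i p q : pts X p -> pts X q -> emb p = emb q -> f i p = f i q.
  by move=> pp qq pq; have [_ [F [V [_ fF _ _]]]] := eigf i; rewrite !fF// pq.
exists (fun i p => f i (al p)); split.
- move=> i; have [inv [F [V [sF fF [sV gV] divV]]]] := eigf i; split.
    move=> g' p g'G pp; have [g gG gg'] := conj _ g'G.
    have [pal eal] := alP _ pp.
    have gX : grp X g by exact: G1.
    have g'X : grp X g' by exact: G2.
    have [pal' eal'] := alP _ (lm_pts mod g'X pp).
    rewrite -(inv _ _ gG pal); apply: eqf => //; first exact: (lm_pts mod).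
    by rewrite eal' (lm_act mod)// (lm_act mod)// eal -!mulmxA gg'.
  exists (fun x => F (x *m A)), (fun x => V (x *m A) *m A^T); split.
  + by apply: (@smooth_lin_comp _ _ _ _ _ (mulmxr A) idfun) => //;
      [exact: mulmxr_continuous|move=> x; exact: cvg_id].
  + by move=> p /alP[pal eal]; rewrite fF// eal.
  + by apply: tangential_gradient_mul => //; split.
  + move=> p /alP[pal eal]; apply: has_divergence_mul => //.
    by rewrite -eal; exact: divV.
- move=> c ind; apply: indf => q pq.
  have [p pp ep] : M (emb q *m A^T) by apply: MAt; exists q.
  rewrite -[RHS](ind p pp); apply: eq_bigr => i _; congr (_ * _).
  have [pal eal] := alP p pp; apply: eqf => //.
  by rewrite eal ep -mulmxA (isometriesK BA) mulmx1.
Qed.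

(** The entries lie in [-1, 1], so cutting this interval into pieces shorter than
    delta leaves finitely many cells. *)
Lemma separating_cells (n : nat) (delta : R) : 0 < delta ->
  exists (C : finType) (cell : 'M[R]_n -> C), forall x y,
    `|x| <= 1 -> `|y| <= 1 -> cell x = cell y -> `|x - y| <= delta.
Proof.
move=> d0.
pose K := (Num.bound delta^-1).
have Kd : 1 < delta * K%:R.
  have : delta^-1 < K%:R by apply: archi_boundP; rewrite invr_ge0 ltW.
  by rewrite -[X in X < _]mulr1 ltr_pdivrMl.
have K0 : (0 : R) < K%:R by rewrite -(pmulr_rgt0 _ d0) (lt_trans _ Kd).
exists {ffun 'I_n * 'I_n -> 'I_(2 * K).+1}.
exists (fun x => [ffun ij => inord (Num.truncn ((x ij.1 ij.2 + 1) * K%:R))]).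
have ent (x : 'M[R]_n) i j : `|x i j| <= 1 ->
    0 <= (x i j + 1) * K%:R /\ (Num.truncn ((x i j + 1) * K%:R) < (2 * K).+1)%N.
  rewrite ler_norml => /andP[x1 x2].
  have h0 : 0 <= (x i j + 1) * K%:R by rewrite mulr_ge0//; lra.
  split=> //; rewrite ltnS -(ler_nat R).
  have /andP[/le_trans -> //] := truncn_itv h0.
  by rewrite natrM ler_pM2r//; lra.
move=> x y x1 y1 /ffunP exy; apply: mx_norm_le => [|i j]; first exact: ltW.
have := exy (i, j); rewrite !ffunE/= => /(congr1 val)/=.
have [hx hx'] := ent x i j (le_trans (entry_le_norm _ _ _) x1).
have [hy hy'] := ent y i j (le_trans (entry_le_norm _ _ _) y1).
rewrite !inordK// => E; rewrite !mxE.
have /andP[a1 a2] := truncn_itv hx; have /andP[b1 b2] := truncn_itv hy.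
rewrite E in a1 a2; rewrite -natr1 in a2 b2.
move: a1 a2 b1 b2 Kd K0; set t := (Num.truncn _)%:R; move: (K%:R : R) => k a1 a2 b1 b2 Kd K0.
have h : `|(x i j - y i j) * k| <= delta * k by rewrite ler_norml; lra.
by move: h; rewrite normrM (gtr0_norm K0) ler_pM2r.
Qed.

(** The code of a group records its order, its multiplication table with respect
    to an enumeration, and the cells that contain its matrices.  Two groups with
    the same code are images of nearby homomorphisms of one group, hence
    conjugate. *)
Lemma finitely_many_eigenspaces (Q : nat) :
  exists (C : finType) (code : {fset elt X} -> C), forall Gam1 Gam2,
    finite_subgroup Gam1 -> finite_subgroup Gam2 ->
    (#|` Gam1| <= Q)%N -> (#|` Gam2| <= Q)%N -> code Gam1 = code Gam2 ->
    forall lam m, dim_eigenspace_ge Gam1 lam m -> dim_eigenspace_ge Gam2 lam m.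
Proof.
have [delta d0 rigid] := isometries_rigid (lm_bilinear mod).
have [C [cell cellP]] := separating_cells (edim X) d0.
pose el (G : {fset elt X}) (i : nat) := nth (gone X) G i.
exists ('I_Q.+1 * {ffun 'I_Q * 'I_Q -> 'I_Q.+1} * {ffun 'I_Q -> C})%type.
exists (fun G => (inord #|` G|,
  [ffun ij => inord (index (gmul (el G (val ij.2)) (el G (val ij.1))) G)],
  [ffun i => cell (rho (el G (val i)))])).
move=> Gam1 Gam2 F1 F2 Q1 Q2 [/(congr1 val)/=].
rewrite !inordK ?ltnS// => q12 /ffunP tab /ffunP cel lam m.
set q := #|` Gam1| in q12.
have lt1 (i : 'I_q) : (i < Q)%N by exact: leq_trans Q1.
have inG (G : {fset elt X}) i : (i < #|` G|)%N -> el G i \in G.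
  by move=> iG; apply: mem_nth.
have idx (G : {fset elt X}) g : g \in G -> (index g G < #|` G|)%N.
  by move=> gG; rewrite index_mem.
have in1 (i : 'I_q) : el Gam1 i \in Gam1 by exact: inG.
have in2 (i : 'I_q) : el Gam2 i \in Gam2 by apply: inG; rewrite -q12.
have [G1 one1 mul1 inv1] := F1; have [G2 one2 mul2 inv2] := F2.
have mlt (i j : 'I_q) : (index (gmul (el Gam1 j) (el Gam1 i)) Gam1 < q)%N.
  by apply: idx; apply: mul1.
pose mul (i j : 'I_q) : 'I_q := Ordinal (mlt i j).
have el1 i j : el Gam1 (mul i j) = gmul (el Gam1 j) (el Gam1 i).
  by rewrite /el/= nth_index//; apply: mul1; apply: in1.
have el2 i j : el Gam2 (mul i j) = gmul (el Gam2 j) (el Gam2 i).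
  have := tab (Ordinal (lt1 i), Ordinal (lt1 j)); rewrite !ffunE/= => /(congr1 val)/=.
  have m2 : gmul (el Gam2 j) (el Gam2 i) \in Gam2 by apply: mul2; exact: in2.
  rewrite !inordK; [|by rewrite ltnS ltnW// (leq_trans (idx _ _ m2))
                    |by rewrite ltnS ltnW// (leq_trans (mlt i j))].
  by move=> E; rewrite /el/= E nth_index.
have q0 : (0 < q)%N by rewrite /q cardfs_gt0; apply/fset0Pn; exists (gone X).
have mulI j : injective (mul^~ j).
  move=> i i' /(congr1 (el Gam1 \o val))/=; rewrite !el1.
  have [h hG [_ hj]] := inv1 _ (in1 j).
  move=> /(congr1 (gmul h)); rewrite !(lm_assoc mod) hj !(lm_unit mod) => E.
  apply/val_inj/eqP.
  by rewrite -(nth_uniq (gone X) _ _ (fset_uniq Gam1)) ?ltn_ord//; apply/eqP.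
have iso1 (i : 'I_q) : isometries B (rho (el Gam1 i)).
  by apply: (lm_isometry mod); apply: G1; exact: in1.
have iso2 (i : 'I_q) : isometries B (rho (el Gam2 i)).
  by apply: (lm_isometry mod); apply: G2; exact: in2.
have [|||A BA conj] := rigid 'I_q (Ordinal q0) mul
   (fun i => rho (el Gam1 i)) (fun i => rho (el Gam2 i)) mulI iso1 iso2.
- by move=> i j; rewrite el1 (lm_mul mod)//; [apply: G1|apply: G1]; exact: in1.
- by move=> i j; rewrite el2 (lm_mul mod)//; [apply: G2|apply: G2]; exact: in2.
- move=> i; apply: cellP.
  + exact: isometries_norm_le (iso1 i).
  + exact: isometries_norm_le (iso2 i).
  + by have := cel (Ordinal (lt1 i)); rewrite !ffunE.
apply: (dim_eigenspace_conj F1 F2 BA) => g' g'G.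
have iq : (index g' Gam2 < q)%N by rewrite q12; exact: idx.
exists (el Gam1 (index g' Gam2)); first exact: (in1 (Ordinal iq)).
by rewrite -(conj (Ordinal iq)) /el/= nth_index.
Qed.

End Conjugation.

(** * Comparison of eigenvalue lists *)

Section Spectra.
Local Open Scope card_scope.
Variables (R : realType) (X : gspace R).
Implicit Types Gam : {fset elt X}.

Lemma dim_eigenspace_ge_le Gam lam m m' : (m <= m')%N ->
  dim_eigenspace_ge Gam lam m' -> dim_eigenspace_ge Gam lam m.
Proof.
move=> mm' [f [eigf indf]]; exists (fun i => f (widen_ord mm' i)).
split=> // c ind i.
pose c' (j : 'I_m') := if insub (val j) is Some k then c k else 0.
have c'w (k : 'I_m) : c' (widen_ord mm' k) = c k by rewrite /c' /= valK.
rewrite -c'w; apply: indf => p pp; rewrite -[RHS](ind p pp).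
rewrite (bigID (fun j : 'I_m' => (j < m)%N))/= [X in _ + X]big1 ?addr0; last first.
  by move=> j jm; rewrite /c' insubN ?mul0r.
rewrite (big_ord_narrow mm')/=; apply: eq_bigr => k _.
by rewrite c'w.
Qed.

Lemma multiplicity_unique Gam lam m m' :
  multiplicity Gam lam m -> multiplicity Gam lam m' -> m = m'.
Proof.
wlog mm' : m m' / (m <= m')%N.
  by move=> H; case/orP: (leq_total m m') => h a b; [|apply/esym]; apply: H.
move=> [_ nm] [m'd _]; apply/eqP; rewrite eqn_leq mm'/= leqNgt; apply/negP => lt.
exact/nm/(dim_eigenspace_ge_le lt).
Qed.

Definition same_eigenspaces Gam1 Gam2 := forall lam m,
  dim_eigenspace_ge Gam1 lam m <-> dim_eigenspace_ge Gam2 lam m.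

Lemma same_eigenspaces_isospectral Gam1 Gam2 :
  same_eigenspaces Gam1 Gam2 -> isospectral Gam1 Gam2.
Proof. by move=> E lam m; rewrite /multiplicity !E. Qed.

(** Two finite sets of the same size are equal as soon as one contains the other. *)
Lemma fiber_eq (u v : nat -> R) lam m :
  [set k | u k = lam] #= `I_m -> [set k | v k = lam] #= `I_m ->
  [set k | v k = lam] `<=` [set k | u k = lam] ->
  [set k | u k = lam] `<=` [set k | v k = lam].
Proof.
set U := [set k | u k = lam]; set W := [set k | v k = lam] => cU cW WU.
have fU : finite_set U by exists m.
have fW : finite_set W by exists m.
have : fset_set W = fset_set U.
  apply/eqP; rewrite eqEfcard (card_fset_set cU) (card_fset_set cW) leqnn andbT.
  by rewrite -fset_set_sub.
by move/(congr1 (fun A : {fset nat} => [set` A])); rewrite !fset_setK// => ->.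
Qed.

(** At the first index k with u1 k < u2 k, all indices at which u2 takes the
    value u1 k come before k, because u2 is nondecreasing.  There u1 and u2 agree,
    so the fiber of u1 over this value strictly contains that of u2, although
    both have the size of the multiplicity. *)
Lemma isospectral_eigenvalue_list Gam1 Gam2 u1 u2 : isospectral Gam1 Gam2 ->
  eigenvalue_list Gam1 u1 -> eigenvalue_list Gam2 u2 -> forall k, u1 k = u2 k.
Proof.
move=> iso [mono1 fib1] [mono2 fib2] k.
have fib lam : exists m, [set k | u1 k = lam] #= `I_m /\ [set k | u2 k = lam] #= `I_m.
  have [m mm c1] := fib1 lam; have [m' mm' c2] := fib2 lam; exists m; split=> //.
  by rewrite (multiplicity_unique (proj1 (iso _ _) mm) mm').
have lt_absurd (u v : nat -> R) (l : nat) :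
    (forall i j, (i <= j)%N -> v i <= v j) ->
    (forall lam, exists m, [set k | u k = lam] #= `I_m /\ [set k | v k = lam] #= `I_m) ->
    (forall j, (j < l)%N -> u j = v j) -> u l < v l -> False.
  move=> mono fibers IH lt; have [m [cu cv]] := fibers (u l).
  have sub : [set k | v k = u l] `<=` [set k | u k = u l].
    move=> j /= vj; rewrite -vj; apply: IH; rewrite ltnNge; apply/negP => lj.
    by have := mono _ _ lj; rewrite vj leNgt lt.
  have /= := fiber_eq cu cv sub (erefl : u l = u l).
  by move=> E; rewrite E ltxx in lt.
elim/ltn_ind: k => k IH.
have [|lt|] := ltgtP (u1 k) (u2 k); last by [].
- by move/(lt_absurd _ _ _ mono2 fib IH).
- have [] := lt_absurd u2 u1 k mono1 _ _ lt.
    by move=> lam; have [m []] := fib lam; exists m.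
  by move=> j jk; rewrite IH.
Qed.

Lemma eigenvalue_list_isospectral Gam1 Gam2 u1 u2 :
  eigenvalue_list Gam1 u1 -> eigenvalue_list Gam2 u2 ->
  (forall k, u1 k = u2 k) -> isospectral Gam1 Gam2.
Proof.
move=> [_ fib1] [_ fib2] /funext u12 lam m; rewrite -{}u12 in fib2.
have [m1 mm1 c1] := fib1 lam; have [m2 mm2 c2] := fib2 lam.
have m12 : m1 = m2.
  by apply/card_eq_II; apply: card_eq_trans c2; rewrite card_eq_sym.
by split=> mm; [rewrite (multiplicity_unique mm mm1) m12|
  rewrite (multiplicity_unique mm mm2) -m12].
Qed.

(** Isospectral groups have equal lists, so a pair of codes determines a pair of
    lists, if lists exist at all, and an index separating them when they differ;
    N is one more than the largest of these indices. *)
Lemma finitely_many_spectra_separated (P : {fset elt X} -> Prop) (C : finType)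
    (code : {fset elt X} -> C) :
  (forall Gam1 Gam2, P Gam1 -> P Gam2 -> code Gam1 = code Gam2 ->
    isospectral Gam1 Gam2) ->
  exists2 N : nat, (0 < N)%N & forall Gam1 Gam2, P Gam1 -> P Gam2 ->
    forall u1 u2, eigenvalue_list Gam1 u1 -> eigenvalue_list Gam2 u2 ->
      (forall k, (k < N)%N -> u1 k = u2 k) -> forall k, u1 k = u2 k.
Proof.
move=> codeP.
have sep (cc : C * C) : exists n, forall Gam1 Gam2 u1 u2, P Gam1 -> P Gam2 ->
    code Gam1 = cc.1 -> code Gam2 = cc.2 ->
    eigenvalue_list Gam1 u1 -> eigenvalue_list Gam2 u2 ->
    (forall k, (k < n)%N -> u1 k = u2 k) -> forall k, u1 k = u2 k.
  have [H|] := pselect (forall Gam1 Gam2 u1 u2, P Gam1 -> P Gam2 ->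
    code Gam1 = cc.1 -> code Gam2 = cc.2 ->
    eigenvalue_list Gam1 u1 -> eigenvalue_list Gam2 u2 -> forall k, u1 k = u2 k).
    by exists 0%N => Gam1 Gam2 u1 u2 P1 P2 c1 c2 l1 l2 _; exact: (H Gam1 Gam2).
  move=> /existsNP[G1] /existsNP[G2] /existsNP[v1] /existsNP[v2].
  move=> /not_implyP[P1] /not_implyP[P2] /not_implyP[c1] /not_implyP[c2].
  move=> /not_implyP[l1] /not_implyP[l2] /existsNP[k vk].
  exists k.+1 => Gam1 Gam2 u1 u2 P1' P2' c1' c2' l1' l2' /(_ k (leqnn _)) uk.
  case: vk.
  rewrite (isospectral_eigenvalue_list (codeP _ _ P1 P1' _) l1 l1'); last by rewrite c1 c1'.
  by rewrite uk (isospectral_eigenvalue_list (codeP _ _ P2' P2 _) l2' l2)// c2 c2'.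
have [n nP] := choice sep.
exists (\max_cc n cc).+1 => // Gam1 Gam2 P1 P2 u1 u2 l1 l2 E.
apply: (nP (code Gam1, code Gam2) Gam1 Gam2) => // k kn.
by apply: E; rewrite ltnS ltnW// (leq_trans kn)// (leq_bigmax (F := n)).
Qed.

End Spectra.

(** The bound on the order comes from |Gam| < 1 / eps. *)
Lemma linear_model_spectrum_determined (R : realType) (X : gspace R) B rho
    (mod : @linear_model R X B rho) (eps : R) (heps : 0 < eps) :
  exists2 N : nat, (0 < N)%N &
    forall Gam1 Gam2 : {fset elt X},
      finite_subgroup Gam1 -> finite_subgroup Gam2 ->
      (#|` Gam1|%:R : R)^-1 > eps -> (#|` Gam2|%:R : R)^-1 > eps ->
      forall u1 u2 : nat -> R,
        eigenvalue_list Gam1 u1 -> eigenvalue_list Gam2 u2 ->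
        (isospectral Gam1 Gam2 <-> forall k : nat, (k < N)%N -> u1 k = u2 k).
Proof.
pose Q := Num.bound eps^-1.
have cardQ (Gam : {fset elt X}) : eps < (#|` Gam|%:R)^-1 -> (#|` Gam| <= Q)%N.
  move=> H; rewrite -(ler_nat R).
  have h : eps^-1 < Q%:R by apply: archi_boundP; rewrite invr_ge0 ltW.
  rewrite (le_trans _ (ltW h))//.
  have c0 : 0 < (#|` Gam|%:R : R) by rewrite -invr_gt0 (lt_trans heps).
  by rewrite -[leLHS]invrK lef_pV2 ?posrE ?invr_gt0// ltW.
have [C [code codeP]] := finitely_many_eigenspaces mod Q.
have [|N N0 NP] := @finitely_many_spectra_separated R X
    (fun Gam => finite_subgroup Gam /\ (#|` Gam| <= Q)%N) C code.
  move=> G1 G2 [F1 Q1] [F2 Q2] c12; apply: same_eigenspaces_isospectral => lam m.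
  by split; apply: codeP.
exists N => // Gam1 Gam2 F1 F2 e1 e2 u1 u2 l1 l2; split.
  by move=> iso k _; exact: (isospectral_eigenvalue_list iso l1 l2).
move=> E; apply: (eigenvalue_list_isospectral l1 l2).
by apply: (NP Gam1 Gam2) => //; split=> //; exact: cardQ.
Qed.

(** * Spheres and flattened matrices *)

Section Basics.
Variable R : realType.

Definition lin_matrix n (f : 'rV[R]_n -> 'rV[R]_n) : 'M[R]_n :=
  \matrix_i f (delta_mx 0 i).

Lemma mul_lin_matrix n (f : 'rV[R]_n -> 'rV[R]_n) : linear f ->
  forall x, x *m lin_matrix f = f x.
Proof.
move=> lf x; rewrite (linear_rVE lf) mulmx_sum_row.
by apply: eq_bigr => i _; rewrite rowK.
Qed.

Lemma dot_isometry n B (A : 'M[R]_n) x y : isometries B A ->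
  dot (x *m A) (y *m A) = dot x y.
Proof. by move=> BA; rewrite dot_mulr -mulmxA (proj1 BA) mulmx1. Qed.

Lemma orthogonal_of_dot n (A : 'M[R]_n) :
  (forall x y, dot (x *m A) (y *m A) = dot x y) -> A *m A^T = 1%:M.
Proof.
move=> H; apply/matrixP => i j.
have -> : (A *m A^T) i j = dot (row i A) (row j A).
  by rewrite mxE; apply: eq_bigr => k _; rewrite !mxE.
rewrite !rowE H /dot (bigD1 i)//= big1 ?addr0 => [|k ki].
  by rewrite !mxE !eqxx mul1r eq_sym.
by rewrite !mxE (negPf ki) andbF mul0r.
Qed.

(** Every orthogonal matrix preserves the zero product. *)
Lemma sphere_model n : linear_model (X := sphere R n)
  (fun _ _ => 0) (fun g : 'M[R]_n.+1 => g^T).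
Proof.
have sq (x : 'cV[R]_n.+1) : \sum_i x i 0 ^+ 2 = dot x^T x^T.
  by apply: eq_bigr => i _; rewrite !mxE expr2.
have iso (g : 'M[R]_n.+1) : g *m g^T = 1%:M ->
    isometries (fun _ _ : 'rV[R]_n.+1 => 0) g^T.
  by move=> go; split=> [|u v]; rewrite ?trmxK ?mul0mx//; exact: mulmx1C.
split=> /=.
- by split=> u a x y; rewrite scaler0 addr0.
- by move=> g [go _]; exact: iso.
- by move=> g h _ _; rewrite trmx_mul.
- move=> g p [go _]; rewrite /= !sq => <-; rewrite trmx_mul.
  exact: dot_isometry (iso _ go).
- by move=> g p _ _; rewrite trmx_mul.
- move=> A x BA [p /= pp <-]; exists (A^T *m p); last by rewrite trmx_mul trmxK.
  rewrite /= sq trmx_mul trmxK (dot_isometry _ _ BA).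
  by rewrite -sq.
- exact: mulmxA.
- exact: mul1mx.
Qed.

Lemma big_mxvec_index (m p : nat) (F : 'I_(m * p) -> R) :
  \sum_k F k = \sum_i \sum_j F (mxvec_index i j).
Proof.
rewrite pair_big/= (reindex (uncurry (@mxvec_index m p)))//=.
  by apply: eq_bigr => -[].
exact: curry_mxvec_bij.
Qed.

Section Flatten.
Variables (K : Type) (d n : nat) (coord : K -> 'rV[R]_d).
Implicit Types X Y Z : 'M[K]_n.
Local Notation flat := (flatten_mx coord (n := n)).

Lemma flatten_mxE X i j k :
  flat X 0 (mxvec_index (mxvec_index i j) k) = Num.sqrt 2^-1 * coord (X i j) 0 k.
Proof. by rewrite mxE mxvecE mxE mxvecE. Qed.

(** The factor 1/2 is the square of the scaling factor in [flatten_mx]. *)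
Lemma dot_flatten_mx X Y :
  dot (flat X) (flat Y) = 2^-1 * \sum_i \sum_j dot (coord (X i j)) (coord (Y i j)).
Proof.
rewrite /dot !big_mxvec_index mulr_sumr; apply: eq_bigr => i _.
rewrite mulr_sumr; apply: eq_bigr => j _; rewrite mulr_sumr; apply: eq_bigr => k _.
by rewrite !flatten_mxE mulrACA -expr2 sqr_sqrtr ?invr_ge0.
Qed.

Lemma flatten_mx_linear a X Y Z :
  (forall i j, coord (Z i j) = a *: coord (X i j) + coord (Y i j)) ->
  flat Z = a *: flat X + flat Y.
Proof.
move=> ZE; apply/rowP; case/mxvec_indexP => ij k; case/mxvec_indexP: ij => i j.
by rewrite [RHS]mxE [in RHS]mxE !flatten_mxE ZE !mxE; ring.
Qed.

End Flatten.

End Basics.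

(** * Complex and quaternionic projective spaces *)

(** What the complex numbers and the quaternions have in common: an involution
    conj, a real part re that is a trace, and real coordinates in which
    re (x conj y) is the Euclidean inner product. *)
Record euclidean_star_ring (R : realType) (K : nzRingType) (conj : K -> K)
    (re : K -> R) (iota : R -> K) (d : nat) (coord : K -> 'rV[R]_d)
    (uncoord : 'rV[R]_d -> K) : Prop := EuclideanStarRing {
  starD : forall x y, conj (x + y) = conj x + conj y;
  starM : forall x y, conj (x * y) = conj y * conj x;
  starK : involutive conj;
  star_fixed : forall x, conj x = x -> x = iota (re x);
  reD : forall x y, re (x + y) = re x + re y;
  re_mulC : forall x y, re (x * y) = re (y * x);
  re1 : re 1 = 1;
  iota1 : iota 1 = 1;
  iotaC : forall a x, iota a * x = x * iota a;
  star_iota : forall a, conj (iota a) = iota a;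
  coordK : cancel coord uncoord;
  uncoordK : cancel uncoord coord;
  coordD : forall x y, coord (x + y) = coord x + coord y;
  coordZ : forall a x, coord (iota a * x) = a *: coord x;
  dot_coord : forall x y, dot (coord x) (coord y) = re (x * conj y) }.

Section StarMatrices.
Variables (R : realType) (K : nzRingType) (conj : K -> K)
    (re : K -> R) (iota : R -> K) (d : nat) (coord : K -> 'rV[R]_d)
    (uncoord : 'rV[R]_d -> K).
Hypothesis star : euclidean_star_ring conj re iota coord uncoord.
Variable n : nat.
Local Notation adj := (adjoint_mx conj).
Local Notation flat := (flatten_mx coord (n := n)).
Local Notation MK := 'M[K]_n.
Local Notation V := 'rV[R]_(n * n * d).
Implicit Types (X Y P g : MK).

Let conj0 : conj 0 = 0.
Proof. by apply: (addrI (conj 0)); rewrite -(starD star) !addr0. Qed.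

Let re0 : re 0 = 0.
Proof. by apply: (addrI (re 0)); rewrite -(reD star) !addr0. Qed.

Let conj_sum (I : finType) (F : I -> K) :
  conj (\sum_i F i) = \sum_i conj (F i).
Proof. exact: (big_morph conj (starD star) conj0). Qed.

Let re_sum (I : finType) (F : I -> K) : re (\sum_i F i) = \sum_i re (F i).
Proof. exact: (big_morph re (reD star) re0). Qed.

Lemma adjK X : adj (adj X) = X.
Proof. by apply/matrixP => i j; rewrite !mxE (starK star). Qed.

Lemma adjM X Y : adj (X *m Y) = adj Y *m adj X.
Proof.
apply/matrixP => i j; rewrite !mxE conj_sum; apply: eq_bigr => k _.
by rewrite !mxE (starM star).
Qed.

Lemma adjD X Y : adj (X + Y) = adj X + adj Y.
Proof. by apply/matrixP => i j; rewrite !mxE (starD star). Qed.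

Lemma adjZ a X : adj (iota a *: X) = iota a *: adj X.
Proof.
by apply/matrixP => i j; rewrite !mxE (starM star) (star_iota star) (iotaC star).
Qed.

Lemma mulmx_iota X a Y : X *m (iota a *: Y) = iota a *: (X *m Y).
Proof.
apply/matrixP => i j; rewrite !mxE mulr_sumr; apply: eq_bigr => k _.
by rewrite !mxE !mulrA (iotaC star).
Qed.

Lemma re_trC X Y : re (\tr (X *m Y)) = re (\tr (Y *m X)).
Proof.
rewrite /mxtrace !re_sum.
rewrite (eq_bigr (fun i => \sum_k re (X i k * Y k i))); last first.
  by move=> i _; rewrite mxE re_sum.
rewrite exchange_big; apply: eq_bigr => k _; rewrite mxE re_sum.
by apply: eq_bigr => i _; exact: (re_mulC star).
Qed.

Lemma tr_fixed X : adj X = X -> \tr X = iota (re (\tr X)).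
Proof.
move=> XE; apply: (star_fixed star); rewrite conj_sum; apply: eq_bigr => i _.
by rewrite -[in RHS]XE !mxE.
Qed.

Let s : R := Num.sqrt 2^-1.
Let s0 : s != 0. Proof. by rewrite gt_eqF// sqrtr_gt0 invr_gt0. Qed.
Definition unflat (v : V) : MK :=
  vec_mx (\row_i uncoord (row i (vec_mx (s^-1 *: v)))).

Lemma flatK : cancel flat unflat.
Proof.
move=> X; rewrite /unflat /flatten_mx scalerA mulVf// scale1r mxvecK.
by rewrite -[RHS]mxvecK; congr vec_mx; apply/rowP => i; rewrite mxE rowK (coordK star).
Qed.

Lemma unflatK : cancel unflat flat.
Proof.
move=> v; rewrite /unflat /flatten_mx vec_mxK.
rewrite [RHS](_ : v = s *: (s^-1 *: v)); last by rewrite scalerA mulfV ?scale1r.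
rewrite -/s; congr (s *: _).
rewrite -[RHS]vec_mxK; congr mxvec; apply/row_matrixP => i.
by rewrite rowK mxE (uncoordK star).
Qed.

Lemma flat_linear a X Y : flat (iota a *: X + Y) = a *: flat X + flat Y.
Proof.
apply: flatten_mx_linear => i j; rewrite mxE mxE.
by rewrite (coordD star) (coordZ star).
Qed.

Lemma unflat_linear a u v : unflat (a *: u + v) = iota a *: unflat u + unflat v.
Proof. by apply: (can_inj flatK); rewrite flat_linear !unflatK. Qed.

Lemma dot_flat X Y : dot (flat X) (flat Y) = 2^-1 * re (\tr (X *m adj Y)).
Proof.
rewrite dot_flatten_mx /mxtrace re_sum; congr (_ * _); apply: eq_bigr => i _.
rewrite mxE re_sum; apply: eq_bigr => j _.
by rewrite (dot_coord star) !mxE.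
Qed.

(** The product x y^* of matrices, in flattened coordinates.  It remembers both
    the product and the adjoint, so that P P^* = P characterizes Hermitian
    idempotents. *)
Definition star_mul (x y : V) : V := flat (unflat x *m adj (unflat y)).

Lemma star_mul_bilinear : bilinear_op star_mul.
Proof.
split=> u a x y; rewrite /star_mul unflat_linear.
  by rewrite mulmxDl -scalemxAl flat_linear.
by rewrite adjD adjZ mulmxDr mulmx_iota flat_linear.
Qed.

Definition conj_action g := lin_matrix (fun x : V => flat (g *m unflat x *m adj g)).

Lemma conj_actionE g x : x *m conj_action g = flat (g *m unflat x *m adj g).
Proof.
rewrite mul_lin_matrix// => a u v.
by rewrite unflat_linear mulmxDr mulmx_iota mulmxDl -scalemxAl flat_linear.
Qed.

Lemma conj_actionM g h : conj_action (g *m h) = conj_action h *m conj_action g.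
Proof.
apply/row_matrixP => i; rewrite !rowE mulmxA !conj_actionE flatK adjM.
by rewrite !mulmxA.
Qed.

Lemma conj_action_isometry g : unitary_group conj g ->
  isometries star_mul (conj_action g).
Proof.
move=> [_ gg].
have E X Y : g *m X *m adj g *m adj (g *m Y *m adj g) = g *m (X *m adj Y) *m adj g.
  by rewrite !adjM adjK !mulmxA -[_ *m adj g *m g]mulmxA gg mulmx1.
split.
  apply: orthogonal_of_dot => x y; rewrite !conj_actionE dot_flat E re_trC.
  by rewrite mulmxA gg mul1mx -dot_flat !unflatK.
by move=> u v; rewrite /star_mul !conj_actionE !flatK E.
Qed.

(** For a Hermitian idempotent P, the trace of P P^* is the trace of P, so trace
    one means that the flattened vector has squared norm 1/2.  Both conditions are
    visibly invariant under the isometries of the product x y^*. *)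
Lemma rank1_projectionsE P : rank1_projections conj P <->
  star_mul (flat P) (flat P) = flat P /\ dot (flat P) (flat P) = 2^-1.
Proof.
rewrite /star_mul flatK dot_flat; split.
  by move=> [-> PP tr1]; rewrite PP tr1 (re1 star) mulr1.
move=> [/(can_inj flatK) PP /eqP]; rewrite -[X in _ == X]mulr1 PP.
rewrite (inj_eq (mulfI _)) ?invr_eq0 ?pnatr_eq0// => /eqP tr1.
have adjP : adj P = P by rewrite -[in LHS]PP adjM adjK.
split=> //; first by rewrite -[in RHS]PP adjP.
by rewrite (tr_fixed adjP) tr1 (iota1 star).
Qed.

Lemma rank1_projections_isometry A P Q : isometries star_mul A ->
  rank1_projections conj P -> flat Q = flat P *m A -> rank1_projections conj Q.
Proof.
move=> BA /rank1_projectionsE[PP P1] QE; apply/rank1_projectionsE.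
by rewrite QE (dot_isometry _ _ BA) (proj2 BA) PP.
Qed.

Lemma conj_action_model (G : set MK) : G `<=` unitary_group conj (n := n) ->
  @linear_model R (@GSpace R MK (rank1_projections conj (n := n)) _ flat MK
    G 1%:M (fun g h => g *m h) (fun g p => g *m p *m adj g)) star_mul conj_action.
Proof.
move=> GU; split=> /=.
- exact: star_mul_bilinear.
- by move=> g /GU; exact: conj_action_isometry.
- by move=> g h _ _; exact: conj_actionM.
- move=> g p /GU Ug pp; apply: rank1_projections_isometry (conj_action_isometry Ug) pp _.
  by rewrite conj_actionE flatK.
- by move=> g p _ _; rewrite conj_actionE flatK.
- move=> A x BA [p /= pp <-]; exists (unflat (flat p *m A)); last exact: unflatK.
  by apply: rank1_projections_isometry BA pp _; rewrite unflatK.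
- exact: mulmxA.
- exact: mul1mx.
Qed.

End StarMatrices.

Section Instances.
Variable R : realType.

Lemma complex_star_ring : euclidean_star_ring (@conjc R) (@complex.Re R)
  (fun a => a +i* 0)%C (@ccoord R) (fun v => v 0 0 +i* v 0 1)%C.
Proof.
split.
- by move=> [a b] [c e]; apply/eqP; rewrite eq_complex/= eqxx opprD eqxx.
- by move=> [a b] [c e]; apply/eqP; rewrite eq_complex/=; apply/andP; split; apply/eqP; ring.
- by move=> [a b]; rewrite /= opprK.
- move=> [a b] /= [/eqP]; rewrite -subr_eq0 -opprD oppr_eq0 -mulr2n mulrn_eq0/=.
  by move=> /eqP ->.
- by move=> [a b] [c e].
- by move=> [a b] [c e] /=; ring.
- by [].
- by [].
- by move=> a [b c]; apply/eqP; rewrite eq_complex/=; apply/andP; split; apply/eqP; ring.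
- by move=> a; rewrite /= oppr0.
- by move=> [a b]; rewrite /ccoord !mxE.
- move=> v; apply/rowP => i; rewrite mxE.
  by case: i => -[|[|//]] p /=; congr (v _ _); apply: val_inj.
- move=> [a b] [c e]; apply/rowP => i; rewrite !mxE.
  by case: i => -[|[|//]] p.
- move=> a [c e]; apply/rowP => i; rewrite !mxE.
  by case: i => -[|[|//]] p /=; ring.
- move=> [a b] [c e]; rewrite /dot !big_ord_recl big_ord0 !mxE/=; ring.
Qed.

Lemma quat_star_ring : euclidean_star_ring (@qconj R) (fun x => x.1.1.1)
  (fun a => (a, 0, 0, 0)) (@qcoord R)
  (fun v => (v 0 (inord 0), v 0 (inord 1), v 0 (inord 2), v 0 (inord 3))).
Proof.
have addE (a b c e a' b' c' e' : R) :
  ((a, b, c, e) : quat R) + (a', b', c', e') = (a + a', b + b', c + c', e + e').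
  by [].
have mulE (x y : quat R) : x * y = qmul x y by [].
split.
- move=> [[[a b] c] e] [[[a' b'] c'] e']; rewrite /= addE /=.
  by rewrite !opprD.
- move=> [[[a b] c] e] [[[a' b'] c'] e'].
  by rewrite !mulE/=; congr (_, _, _, _); ring.
- by move=> [[[a b] c] e] /=; rewrite !opprK.
- have opp0 (x : R) : - x = x -> x = 0.
    by move=> /eqP; rewrite -subr_eq0 -opprD oppr_eq0 -mulr2n mulrn_eq0/= => /eqP.
  by move=> [[[a b] c] e] /= [/opp0-> /opp0-> /opp0->].
- by move=> [[[a b] c] e] [[[a' b'] c'] e'].
- by move=> [[[a b] c] e] [[[a' b'] c'] e']; rewrite !mulE/=; ring.
- by [].
- by [].
- move=> a [[[a' b'] c'] e'].
  by rewrite !mulE/=; congr (_, _, _, _); ring.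
- by move=> a; rewrite /= !oppr0.
- by move=> [[[a b] c] e]; rewrite /qcoord !mxE !inordK.
- move=> v; apply/rowP => i; rewrite mxE.
  by case: i => -[|[|[|[|//]]]] p /=; congr (v _ _); apply: val_inj; rewrite /= inordK.
- move=> [[[a b] c] e] [[[a' b'] c'] e']; apply/rowP => i; rewrite !mxE.
  by case: i => -[|[|[|[|//]]]] p.
- move=> a [[[a' b'] c'] e']; apply/rowP => i; rewrite !mxE.
  by case: i => -[|[|[|[|//]]]] p /=; ring.
- move=> [[[a b] c] e] [[[a' b'] c'] e'].
  by rewrite /dot !big_ord_recl big_ord0 !mxE mulE/=; ring.
Qed.

End Instances.

(** * Octonions *)

Section Octonions.
Variable R : realType.
Implicit Types x y z u v w : oct R.

Let addE (a b c e a' b' c' e' : R) :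
  ((a, b, c, e) : quat R) + (a', b', c', e') = (a + a', b + b', c + c', e + e').
Proof. by []. Qed.
Let oppE (a b c e : R) :
  - ((a, b, c, e) : quat R) = (- a, - b, - c, - e).
Proof. by []. Qed.
Let mulE (x y : quat R) : x * y = qmul x y. Proof. by []. Qed.
Let scaleE (t a b c e : R) :
  t *: ((a, b, c, e) : quat R) = (t * a, t * b, t * c, t * e).
Proof. by []. Qed.
Let oaddE (p q p' q' : quat R) : ((p, q) : oct R) + (p', q') = (p + p', q + q').
Proof. by []. Qed.
Let oscaleE (t : R) (p q : quat R) : t *: ((p, q) : oct R) = (t *: p, t *: q).
Proof. by []. Qed.
Let ooppE (p q : quat R) : - ((p, q) : oct R) = (- p, - q).
Proof. by []. Qed.

Definition odot x y : R := dot (ocoord x) (ocoord y).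

Lemma odotE (a b c e f g h k a' b' c' e' f' g' h' k' : R) :
  odot ((a, b, c, e), (f, g, h, k)) ((a', b', c', e'), (f', g', h', k')) =
  a * a' + b * b' + c * c' + e * e' + f * f' + g * g' + h * h' + k * k'.
Proof.
rewrite /odot /dot big_split_ord/= /ocoord.
under eq_bigr do rewrite !row_mxEl.
under [X in _ + X]eq_bigr do rewrite !row_mxEr.
by rewrite !big_ord_recl !big_ord0 !mxE/=; ring.
Qed.

Let orealE (t : R) : oreal t = ((t, 0, 0, 0), (0, 0, 0, 0)). Proof. by []. Qed.

Let regE (t a : R) : t *: (a : R^o) = t * a. Proof. by []. Qed.

Let octE := (oaddE, ooppE, oscaleE, mulE, addE, oppE, scaleE, regE).

Ltac oct_simp := rewrite ?orealE /omul /oconj /ore /=;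
  repeat (progress rewrite ?octE /=).

Ltac oct_dest x := case: x => [[[[? ?] ?] ?] [[[? ?] ?] ?]].

Lemma oconjK x : oconj (oconj x) = x.
Proof. by oct_dest x; oct_simp; rewrite !opprK. Qed.

Lemma odot_oreal (s t : R) : odot (oreal s) (oreal t) = s * t.
Proof. by rewrite !orealE odotE; ring. Qed.

Lemma odotC x y : odot x y = odot y x.
Proof. by rewrite /odot /dot; apply: eq_bigr => i _; rewrite mulrC. Qed.

Lemma odot_linear_l t x y z : odot (t *: x + y) z = t * odot x z + odot y z.
Proof.
by oct_dest x; oct_dest y; oct_dest z; rewrite oscaleE oaddE !scaleE !addE !odotE; ring.
Qed.

Lemma odot_conj x y : odot (oconj x) y = odot x (oconj y).
Proof. by oct_dest x; oct_dest y; rewrite /oconj/= !oppE !odotE; ring. Qed.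

Lemma odot0 x : odot 0 x = 0.
Proof. by have := odot_linear_l (-1) x x x; rewrite scaleN1r addNr mulN1r addNr. Qed.

Lemma odotZ t x y : odot (t *: x) y = t * odot x y.
Proof. by rewrite -[t *: x]addr0 odot_linear_l odot0 addr0. Qed.

Lemma odotD x y z : odot (x + y) z = odot x z + odot y z.
Proof. by rewrite -{1}[x]scale1r odot_linear_l mul1r. Qed.

Lemma odot_inj x y : (forall z, odot z x = odot z y) -> x = y.
Proof.
oct_dest x; oct_dest y => H.
have := H ((1, 0, 0, 0), (0, 0, 0, 0)); have := H ((0, 1, 0, 0), (0, 0, 0, 0)).
have := H ((0, 0, 1, 0), (0, 0, 0, 0)); have := H ((0, 0, 0, 1), (0, 0, 0, 0)).
have := H ((0, 0, 0, 0), (1, 0, 0, 0)); have := H ((0, 0, 0, 0), (0, 1, 0, 0)).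
have := H ((0, 0, 0, 0), (0, 0, 1, 0)); have := H ((0, 0, 0, 0), (0, 0, 0, 1)).
by rewrite !odotE !(mul0r, mul1r, addr0, add0r) => -> -> -> -> -> -> -> ->.
Qed.

Lemma oreal_mul t x : omul (oreal t) x = t *: x.
Proof. by oct_dest x; oct_simp; congr ((_, _, _, _), (_, _, _, _)); ring. Qed.

Lemma omul_real t x : omul x (oreal t) = t *: x.
Proof. by oct_dest x; oct_simp; congr ((_, _, _, _), (_, _, _, _)); ring. Qed.

Lemma ore_omul_conj x y : ore (omul x (oconj y)) = odot x y.
Proof. by oct_dest x; oct_dest y; rewrite odotE; oct_simp; ring. Qed.

Lemma ore_conj_omul x y : ore (omul (oconj x) y) = odot x y.
Proof. by oct_dest x; oct_dest y; rewrite odotE; oct_simp; ring. Qed.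

(** With tri(u, v, w) the real part of u (v w), this is the invariance of tri
    under cyclic permutations although the product is not associative. *)
Lemma odot_mul_cyclic u v w :
  odot u (omul (oconj w) (oconj v)) = odot v (omul (oconj u) (oconj w)).
Proof.
by oct_dest u; oct_dest v; oct_dest w; oct_simp; rewrite !odotE; ring.
Qed.

Lemma ocoord_linear t x y : ocoord (t *: x + y) = t *: ocoord x + ocoord y.
Proof.
oct_dest x; oct_dest y; rewrite !octE /ocoord scale_row_mx add_row_mx.
by congr row_mx; apply/rowP => -[[|[|[|[|//]]]] p]; rewrite !mxE.
Qed.

Lemma oconj_linear t x y : oconj (t *: x + y) = t *: oconj x + oconj y.
Proof.
by oct_dest x; oct_dest y; oct_simp; congr ((_, _, _, _), (_, _, _, _)); ring.
Qed.

Lemma oreal_linear (t a b : R) : oreal (t * a + b) = t *: oreal a + oreal b.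
Proof. by oct_simp; congr ((_, _, _, _), (_, _, _, _)); ring. Qed.

(** The representing octonion has as coordinates the values of psi on the eight
    basis units. *)
Lemma odot_riesz (psi : oct R -> R) :
  (forall t x y, psi (t *: x + y) = t * psi x + psi y) ->
  exists x, forall y, odot y x = psi y.
Proof.
move=> lin.
exists ((psi ((1, 0, 0, 0), (0, 0, 0, 0)), psi ((0, 1, 0, 0), (0, 0, 0, 0)),
         psi ((0, 0, 1, 0), (0, 0, 0, 0)), psi ((0, 0, 0, 1), (0, 0, 0, 0))),
        (psi ((0, 0, 0, 0), (1, 0, 0, 0)), psi ((0, 0, 0, 0), (0, 1, 0, 0)),
         psi ((0, 0, 0, 0), (0, 0, 1, 0)), psi ((0, 0, 0, 0), (0, 0, 0, 1)))).
have linE (t a b c e f g h k a' b' c' e' f' g' h' k' : R) :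
  psi ((t * a + a', t * b + b', t * c + c', t * e + e'),
       (t * f + f', t * g + g', t * h + h', t * k + k')) =
  t * psi ((a, b, c, e), (f, g, h, k)) + psi ((a', b', c', e'), (f', g', h', k'))
  by exact: (lin t ((a, b, c, e), (f, g, h, k)) ((a', b', c', e'), (f', g', h', k'))).
have psi0 : psi ((0, 0, 0, 0), (0, 0, 0, 0)) = 0.
  have := linE (-1) 0 0 0 0 0 0 0 0 0 0 0 0 0 0 0 0.
  by rewrite !(mulr0, addr0) mulN1r addNr.
move=> [[[[a b] c] e] [[[f g] h] k]]; rewrite odotE.
have := linE a 1 0 0 0 0 0 0 0 0 b c e f g h k.
have := linE b 0 1 0 0 0 0 0 0 0 0 c e f g h k.
have := linE c 0 0 1 0 0 0 0 0 0 0 0 e f g h k.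
have := linE e 0 0 0 1 0 0 0 0 0 0 0 0 f g h k.
have := linE f 0 0 0 0 1 0 0 0 0 0 0 0 0 g h k.
have := linE g 0 0 0 0 0 1 0 0 0 0 0 0 0 0 h k.
have := linE h 0 0 0 0 0 0 1 0 0 0 0 0 0 0 0 k.
have := linE k 0 0 0 0 0 0 0 1 0 0 0 0 0 0 0 0.
rewrite !(mulr1, mulr0, addr0, add0r) psi0 => -> -> -> -> -> -> -> ->.
by rewrite addr0 !addrA.
Qed.

End Octonions.

(** * The Albert algebra *)

Section Albert.
Variable R : realType.
Local Notation J := (albert R).

(** Half the trace of the Jordan product, see [albert_tr_jordan]; the factor makes
    it the inner product of the embedding, see [dot_albert_emb]. *)
Definition albert_dot (x y : J) : R :=
  2^-1 * (x.1.1.1 * y.1.1.1 + x.1.1.2 * y.1.1.2 + x.1.2 * y.1.2) +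
  (odot x.2.1.1 y.2.1.1 + odot x.2.1.2 y.2.1.2 + odot x.2.2 y.2.2).

Lemma albert_scaleE (t c1 c2 c3 : R) (z1 z2 z3 : oct R) :
  t *: (((c1, c2, c3), (z1, z2, z3)) : J) =
  ((t * c1, t * c2, t * c3), (t *: z1, t *: z2, t *: z3)).
Proof. by []. Qed.

Lemma albert_addE (b1 b2 b3 c1 c2 c3 : R) (y1 y2 y3 z1 z2 z3 : oct R) :
  (((b1, b2, b3), (y1, y2, y3)) : J) + ((c1, c2, c3), (z1, z2, z3)) =
  ((b1 + c1, b2 + c2, b3 + c3), (y1 + z1, y2 + z2, y3 + z3)).
Proof. by []. Qed.

Lemma ore_lin t (x y : oct R) : ore (t *: x + y) = t * ore x + ore y.
Proof. by case: x => -[[[? ?] ?] ?] ?; case: y => -[[[? ?] ?] ?] ?. Qed.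

Lemma oreD (x y : oct R) : ore (x + y) = ore x + ore y.
Proof. by have := ore_lin 1 x y; rewrite scale1r mul1r. Qed.

Lemma ore_oreal (t : R) : ore (oreal t) = t.
Proof. by []. Qed.

Lemma oreal_omul_oreal (s t : R) : ore (omul (oreal s) (oreal t)) = s * t.
Proof. by rewrite oreal_mul -[_ *: _]addr0 ore_lin !ore_oreal addr0. Qed.

(** The Jordan product in coordinates; the three off-diagonal slots are permuted
    cyclically. *)
Lemma jordanE (a1 a2 a3 b1 b2 b3 : R) (x1 x2 x3 y1 y2 y3 : oct R) :
  jordan (((a1, a2, a3), (x1, x2, x3)) : J) ((b1, b2, b3), (y1, y2, y3)) =
  ((a1 * b1 + odot x2 y2 + odot x3 y3,
    a2 * b2 + odot x1 y1 + odot x3 y3,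
    a3 * b3 + odot x1 y1 + odot x2 y2),
   (2^-1 *: ((a2 + a3) *: y1 + (b2 + b3) *: x1 +
       omul (oconj x3) (oconj y2) + omul (oconj y3) (oconj x2)),
    2^-1 *: ((a3 + a1) *: y2 + (b3 + b1) *: x2 +
       omul (oconj x1) (oconj y3) + omul (oconj y1) (oconj x3)),
    2^-1 *: ((a1 + a2) *: y3 + (b1 + b2) *: x3 +
       omul (oconj x2) (oconj y1) + omul (oconj y2) (oconj x1)))).
Proof.
rewrite /jordan /mx_albert !mxE !big_ord_recl !big_ord0 /albert_mx !mxE.
rewrite !inordK//=.
rewrite !oreD !addr0 !oreal_omul_oreal !ore_omul_conj !ore_conj_omul.
rewrite !oreal_mul !omul_real !scalerDl !addrA.
rewrite (odotC y1) (odotC y2) (odotC y3).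
rewrite albert_scaleE; congr ((_, _, _), (_, _, _)).
- by field.
- by field.
- by field.
- by rewrite [in LHS](ACl (2*6*5*3*1*4)).
- by rewrite [in LHS](ACl (3*4*6*1*2*5)).
- by rewrite [in LHS](ACl (1*5*4*2*3*6)).
Qed.

Lemma albert_dotC (x y : J) : albert_dot x y = albert_dot y x.
Proof.
by congr (_ * (_ + _ + _) + (_ + _ + _)); first [exact: mulrC|exact: odotC].
Qed.

Lemma albert_dot_linear_l t (x y z : J) :
  albert_dot (t *: x + y) z = t * albert_dot x z + albert_dot y z.
Proof.
case: x => -[[a1 a2] a3] [[x1 x2] x3]; case: y => -[[b1 b2] b3] [[y1 y2] y3].
case: z => -[[c1 c2] c3] [[z1 z2] z3].
by rewrite albert_scaleE albert_addE /albert_dot/= !odot_linear_l; ring.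
Qed.

Lemma albert_dot_inj (x y : J) :
  (forall w, albert_dot w x = albert_dot w y) -> x = y.
Proof.
case: x => -[[a1 a2] a3] [[x1 x2] x3]; case: y => -[[b1 b2] b3] [[y1 y2] y3] H.
have := H ((2, 0, 0), (0, 0, 0)); have := H ((0, 2, 0), (0, 0, 0)).
have := H ((0, 0, 2), (0, 0, 0)).
rewrite /albert_dot/= !odot0 !(mul0r, addr0, add0r) !mulrA mulVf ?pnatr_eq0//.
rewrite !mul1r => -> -> ->.
congr (_, (_, _, _)); apply: odot_inj => z.
- have := H ((0, 0, 0), (z, 0, 0)).
  by rewrite /albert_dot/= !odot0 !(mul0r, mulr0, addr0, add0r).
- have := H ((0, 0, 0), (0, z, 0)).
  by rewrite /albert_dot/= !odot0 !(mul0r, mulr0, addr0, add0r).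
- have := H ((0, 0, 0), (0, 0, z)).
  by rewrite /albert_dot/= !odot0 !(mul0r, mulr0, addr0, add0r).
Qed.

Lemma albert_tr_jordan (x y : J) : albert_tr (jordan x y) = 2 * albert_dot x y.
Proof.
case: x => -[[a1 a2] a3] [[x1 x2] x3]; case: y => -[[b1 b2] b3] [[y1 y2] y3].
by rewrite jordanE /albert_tr /albert_dot/=; field.
Qed.

(** The trace of x o (y o z) is symmetric: its cubic part is a sum of terms
    re (u (v w)) over all ways to distribute the three arguments on the three
    off-diagonal slots, and these terms are cyclically invariant. *)
Lemma albert_dot_jordan_swap (x y z : J) :
  albert_dot x (jordan y z) = albert_dot y (jordan x z).
Proof.
case: x => -[[a1 a2] a3] [[x1 x2] x3]; case: y => -[[b1 b2] b3] [[y1 y2] y3].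
case: z => -[[c1 c2] c3] [[z1 z2] z3]; rewrite !jordanE /albert_dot/=.
rewrite !(odotC _ (2^-1 *: _)) !odotZ !odotD !odotZ.
rewrite !(odotC (omul _ _)).
rewrite (odotC z1 x1) (odotC z2 x2) (odotC z3 x3) (odotC y1 x1) (odotC y2 x2).
rewrite (odotC y3 x3) (odotC z1 y1) (odotC z2 y2) (odotC z3 y3).
rewrite (odot_mul_cyclic y1 z2 x3) (odot_mul_cyclic z2 x3 y1).
rewrite (odot_mul_cyclic y1 x2 z3) (odot_mul_cyclic y2 z3 x1).
rewrite (odot_mul_cyclic z3 x1 y2) (odot_mul_cyclic y2 x3 z1).
rewrite (odot_mul_cyclic y3 z1 x2) (odot_mul_cyclic z1 x2 y3).
rewrite (odot_mul_cyclic y3 x1 z2); ring.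
Qed.

Lemma albert_dot_linear_r t (x y z : J) :
  albert_dot z (t *: x + y) = t * albert_dot z x + albert_dot z y.
Proof. by rewrite !(albert_dotC z) albert_dot_linear_l. Qed.

Lemma jordanC (x y : J) : jordan x y = jordan y x.
Proof. by rewrite /jordan addrC. Qed.

(** Multiplication by z is self-adjoint for a nondegenerate form, hence linear. *)
Lemma jordan_linear_l t (x y z : J) :
  jordan (t *: x + y) z = t *: jordan x z + jordan y z.
Proof.
apply: albert_dot_inj => w.
apply: etrans (albert_dot_jordan_swap w (t *: x + y) z) _.
apply: etrans (albert_dot_linear_l t x y (jordan w z)) _.
apply: etrans (esym (albert_dot_linear_r t (jordan x z) (jordan y z) w)).
exact: (congr2 (fun p q => t * p + q) (albert_dot_jordan_swap x w z)
  (albert_dot_jordan_swap y w z)).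
Qed.

Lemma jordan_linear_r t (x y z : J) :
  jordan z (t *: x + y) = t *: jordan z x + jordan z y.
Proof.
rewrite (jordanC z x) (jordanC z y) (jordanC z (t *: x + y)); exact: jordan_linear_l.
Qed.

Definition albert1 : J := ((1, 1, 1), (0, 0, 0)).

Lemma omul0 (x : oct R) : omul x 0 = 0.
Proof. by have := omul_real 0 x; rewrite scale0r. Qed.

Lemma mul0o (x : oct R) : omul 0 x = 0.
Proof. by have := oreal_mul 0 x; rewrite scale0r. Qed.

Lemma oconj0 : oconj 0 = 0 :> oct R.
Proof. by rewrite /oconj/= !oppr0. Qed.

Lemma jordan1 (x : J) : jordan albert1 x = x.
Proof.
case: x => -[[b1 b2] b3] [[y1 y2] y3]; rewrite /albert1 jordanE.
have half (y : oct R) (b : R) : 2^-1 *: ((1 + 1) *: y + b *: 0) = y.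
  by rewrite scaler0 addr0 scalerA -(natrD R 1 1) mulVf ?scale1r// pnatr_eq0.
by congr ((_, _, _), (_, _, _)); rewrite ?oconj0 ?mul0o ?omul0 ?odot0 ?addr0 ?mul1r.
Qed.

Ltac jordan_simp := rewrite jordanE; congr ((_, _, _), (_, _, _));
  rewrite ?(oconj0, mul0o, omul0, odot0, scaler0, scale0r, addr0,
    add0r, mul0r, mulr0, mul1r, mulr1, scale1r).

(** The vector y o (x o z) - x o (y o z) is w / 4 for x = z a diagonal idempotent
    and y = w in the off-diagonal slots that meet it, and it is a multiple of a
    difference of two diagonal idempotents for x = z an off-diagonal unit.  These
    vectors and 1 span the algebra.  Subtraction is written as adding the multiple
    by -1 so that all closure properties have one shape. *)
Lemma associator_ind (P : J -> Prop) :
  (forall t x y, P x -> P y -> P (t *: x + y)) -> P albert1 ->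
  (forall x y z, P ((-1) *: jordan x (jordan y z) + jordan y (jordan x z))) ->
  forall x, P x.
Proof.
move=> Plin P1 Pass.
pose e1 : J := ((1, 0, 0), (0, 0, 0)); pose e2 : J := ((0, 1, 0), (0, 0, 0)).
pose u1 : J := ((0, 0, 0), (oreal 1, 0, 0)).
pose u3 : J := ((0, 0, 0), (0, 0, oreal 1)).
have r1 : odot (oreal 1) (oreal 1) = 1 :> R.
  by rewrite -ore_omul_conj oreal_mul scale1r.
have odotr0 (x : oct R) : odot x 0 = 0 by rewrite odotC odot0.
have e1u (y2 y3 : oct R) :
    jordan e1 ((0, 0, 0), (0, y2, y3)) = ((0, 0, 0), (0, 2^-1 *: y2, 2^-1 *: y3)).
  by jordan_simp; rewrite ?odotr0.
have e2u (y1 : oct R) :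
    jordan e2 ((0, 0, 0), (y1, 0, 0)) = ((0, 0, 0), (2^-1 *: y1, 0, 0)).
  by jordan_simp; rewrite ?odotr0.
have e1e1 : jordan e1 e1 = e1 by jordan_simp.
have e2e2 : jordan e2 e2 = e2 by jordan_simp.
have lin t (a1 a2 a3 b1 b2 b3 : R) (x1 x2 x3 y1 y2 y3 : oct R) :
    P ((a1, a2, a3), (x1, x2, x3)) -> P ((b1, b2, b3), (y1, y2, y3)) ->
    P ((t * a1 + b1, t * a2 + b2, t * a3 + b3),
       (t *: x1 + y1, t *: x2 + y2, t *: x3 + y3)) by exact: Plin.
(* The factor 4 in the next steps cancels w / 4. *)
have quarter (y : oct R) : (-1) *: (2^-1 *: (2^-1 *: (4 *: y))) + 2^-1 *: (4 *: y) = y.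
  rewrite !scalerA -scalerDl.
  by rewrite (_ : _ + _ = 1) ?scale1r//; field.
have Pw (y2 y3 : oct R) : P ((0, 0, 0), (0, y2, y3)).
  have := Pass e1 ((0, 0, 0), (0, 4 *: y2, 4 *: y3)) e1.
  rewrite e1e1 !(jordanC _ e1) !e1u albert_scaleE albert_addE !quarter.
  by rewrite !(mulr0, scaler0, addr0).
have Pw1 (y1 : oct R) : P ((0, 0, 0), (y1, 0, 0)).
  have := Pass e2 ((0, 0, 0), (4 *: y1, 0, 0)) e2.
  rewrite e2e2 !(jordanC _ e2) !e2u albert_scaleE albert_addE !quarter.
  by rewrite !(mulr0, scaler0, addr0).
have u33 (x y : oct R) : jordan ((0, 0, 0), (0, 0, x)) ((0, 0, 0), (0, 0, y)) =
    (((odot x y, odot x y, 0), (0, 0, 0)) : J) by jordan_simp.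
have u11 (x y : oct R) : jordan ((0, 0, 0), (x, 0, 0)) ((0, 0, 0), (y, 0, 0)) =
    (((0, odot x y, odot x y), (0, 0, 0)) : J) by jordan_simp.
have e1d : jordan e1 ((1, 1, 0), (0, 0, 0)) = e1 by jordan_simp.
have e2d : jordan e2 ((0, 1, 1), (0, 0, 0)) = e2 by jordan_simp.
have r2 : odot (oreal 1) (2^-1 *: oreal 1) = 2^-1 :> R.
  by rewrite odotC odotZ r1 mulr1.
have D1 : P ((2^-1, - 2^-1, 0), (0, 0, 0)).
  have := Pass u3 e1 u3; rewrite /u3 e1u scaler0 !u33 r1 r2 e1d.
  rewrite albert_scaleE albert_addE !(mulr0, scaler0, addr0) !mulN1r.
  by rewrite (_ : - 2^-1 + 1 = 2^-1) //; field.
have D2 : P ((0, 2^-1, - 2^-1), (0, 0, 0)).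
  have := Pass u1 e2 u1; rewrite /u1 e2u !u11 r1 r2 e2d.
  rewrite albert_scaleE albert_addE !(mulr0, scaler0, addr0) !mulN1r.
  by rewrite (_ : - 2^-1 + 1 = 2^-1) //; field.
case=> -[[b1 b2] b3] [[y1 y2] y3].
(* t is the multiple of 1 to be split off; the rest of the diagonal has trace
   zero and is a combination of (1/2, -1/2, 0) and (0, 1/2, -1/2). *)
pose t := (b1 + b2 + b3) / 3.
have := lin t _ _ _ _ _ _ _ _ _ _ _ _ P1 (lin (2 * (b1 - t)) _ _ _ _ _ _ _ _ _ _ _ _ D1
  (lin (- 2 * (b3 - t)) _ _ _ _ _ _ _ _ _ _ _ _ D2 (lin 1 _ _ _ _ _ _ _ _ _ _ _ _ (Pw1 y1) (Pw y2 y3)))).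
rewrite !(mulr0, scaler0, addr0, add0r, scale1r).
move=> H; apply: (eq_ind _ P H); by congr ((_, _, _), (_, _, _)); rewrite /t; field.
Qed.

Section Automorphism.
Variable g : J -> J.
Hypotheses (g_lin : linear g) (g_bij : bijective g)
  (g_jordan : {morph g : x y / jordan x y}).

Lemma F4_albert1 : g albert1 = albert1.
Proof.
have [k kg gk] := g_bij.
have unit_g y : jordan (g albert1) y = y by rewrite -{1}(gk y) -g_jordan jordan1.
by rewrite -[LHS]jordan1 jordanC unit_g.
Qed.

Lemma albert_tr_linear t (x y : J) : albert_tr (t *: x + y) = t * albert_tr x + albert_tr y.
Proof.
case: x => -[[a1 a2] a3] [[x1 x2] x3]; case: y => -[[b1 b2] b3] [[y1 y2] y3].
by rewrite albert_scaleE albert_addE /albert_tr/=; ring.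
Qed.

Lemma albert_tr_associator (x y z : J) :
  albert_tr ((-1) *: jordan x (jordan y z) + jordan y (jordan x z)) = 0.
Proof.
apply: etrans (albert_tr_linear _ _ _) _; apply/eqP; rewrite mulN1r addrC subr_eq0; apply/eqP.
apply: etrans (albert_tr_jordan y (jordan x z)) _.
apply: etrans (esym (albert_tr_jordan x (jordan y z))).
exact: (congr1 (fun s => 2 * s) (albert_dot_jordan_swap y x z)).
Qed.

(** Automorphisms fix 1 and map y o (x o z) - x o (y o z) to a vector of the same
    form, on which the trace vanishes. *)
Lemma F4_tr x : albert_tr (g x) = albert_tr x.
Proof.
elim/associator_ind: x => [t x y gx gy||x y z].
- rewrite (g_lin t x y); apply: etrans (albert_tr_linear t (g x) (g y)) _.
  by rewrite gx gy; exact: esym (albert_tr_linear t x y).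
- by rewrite F4_albert1.
- apply: etrans (esym (albert_tr_associator x y z)).
  apply: etrans (congr1 (@albert_tr R) (g_lin (-1) _ _)) _.
  apply: etrans (albert_tr_associator (g x) (g y) (g z)).
  by rewrite -!g_jordan.
Qed.

(** The inner product is half the trace of the Jordan product. *)
Lemma F4_dot x y : albert_dot (g x) (g y) = albert_dot x y.
Proof.
have n2 : (2 : R) != 0 by rewrite pnatr_eq0.
by apply: (mulfI n2); rewrite -!albert_tr_jordan -g_jordan F4_tr.
Qed.

End Automorphism.
End Albert.

(** * The octonionic plane *)

Section OctonionModel.
Variable R : realType.
Local Notation J := (albert R).
Local Notation V := 'rV[R]_(3 * 3 * (4 + 4)).

Definition albert_emb (p : J) : V := flatten_mx (@ocoord R) (albert_mx p).

Lemma albert_emb_linear t (p q : J) :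
  albert_emb (t *: p + q) = t *: albert_emb p + albert_emb q.
Proof.
apply: flatten_mx_linear.
case: p => -[[a1 a2] a3] [[x1 x2] x3]; case: q => -[[b1 b2] b3] [[y1 y2] y3].
rewrite albert_scaleE albert_addE /albert_mx => i j; rewrite !mxE -ocoord_linear.
case: i => -[|[|[|//]]] ? /=; case: j => -[|[|[|//]]] ? /=;
  by rewrite ?oreal_linear ?oconj_linear.
Qed.

Lemma dot_albert_emb (p q : J) : dot (albert_emb p) (albert_emb q) = albert_dot p q.
Proof.
have odot_conj2 (x y : oct R) : odot (oconj x) (oconj y) = odot x y.
  by rewrite odot_conj oconjK.
rewrite dot_flatten_mx.
case: p => -[[a1 a2] a3] [[x1 x2] x3]; case: q => -[[b1 b2] b3] [[y1 y2] y3].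
rewrite !big_ord_recl !big_ord0 /albert_mx !mxE/= -!/(odot _ _).
by rewrite !odot_oreal !odot_conj2 /albert_dot/=; field.
Qed.

Lemma albert_riesz (phi : J -> R) :
  (forall t x y, phi (t *: x + y) = t * phi x + phi y) ->
  exists p, forall q, albert_dot q p = phi q.
Proof.
move=> lin.
have [x1 H1] : exists x, forall y, odot y x = phi ((0, 0, 0), (y, 0, 0)).
  apply: odot_riesz => t x y; rewrite -lin albert_scaleE albert_addE.
  by rewrite !(mulr0, scaler0, addr0).
have [x2 H2] : exists x, forall y, odot y x = phi ((0, 0, 0), (0, y, 0)).
  apply: odot_riesz => t x y; rewrite -lin albert_scaleE albert_addE.
  by rewrite !(mulr0, scaler0, addr0).
have [x3 H3] : exists x, forall y, odot y x = phi ((0, 0, 0), (0, 0, y)).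
  apply: odot_riesz => t x y; rewrite -lin albert_scaleE albert_addE.
  by rewrite !(mulr0, scaler0, addr0).
exists ((2 * phi ((1, 0, 0), (0, 0, 0)), 2 * phi ((0, 1, 0), (0, 0, 0)),
         2 * phi ((0, 0, 1), (0, 0, 0))), (x1, x2, x3)).
move=> [[[a1 a2] a3] [[y1 y2] y3]]; rewrite /albert_dot/= H1 H2 H3.
have linE (t a b c a' b' c' : R) (u v w u' v' w' : oct R) :
  phi ((t * a + a', t * b + b', t * c + c'), (t *: u + u', t *: v + v', t *: w + w')) =
  t * phi ((a, b, c), (u, v, w)) + phi ((a', b', c'), (u', v', w'))
  by exact: (lin t ((a, b, c), (u, v, w)) ((a', b', c'), (u', v', w'))).
have := linE a1 1 0 0 0 a2 a3 0 0 0 y1 y2 y3.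
have := linE a2 0 1 0 0 0 a3 0 0 0 y1 y2 y3.
have := linE a3 0 0 1 0 0 0 0 0 0 y1 y2 y3.
have := linE 1 0 0 0 0 0 0 y1 0 0 0 y2 y3.
have := linE 1 0 0 0 0 0 0 0 y2 0 0 0 y3.
rewrite !(mulr1, mulr0, addr0, add0r, scaler0, scale1r, mul1r) => E1 E2 E3 E4 E5.
by rewrite E5 E4 E3 E2 E1; field.
Qed.

Lemma dot_linear_l n t (x y z : 'rV[R]_n) :
  dot (t *: x + y) z = t * dot x z + dot y z.
Proof. by rewrite !dotE mulmxDl -scalemxAl !mxE. Qed.

Lemma dotC n (x y : 'rV[R]_n) : dot x y = dot y x.
Proof. by apply: eq_bigr => i _; rewrite mulrC. Qed.

Lemma dot_linear_r n t (x y z : 'rV[R]_n) :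
  dot z (t *: x + y) = t * dot z x + dot z y.
Proof. by rewrite !(dotC z) dot_linear_l. Qed.

(** The adjoint of the embedding, which is an isometry; the adjoint is therefore
    a left inverse of it. *)
Lemma albert_proj_exists : exists pi : V -> J,
  forall v p, albert_dot p (pi v) = dot (albert_emb p) v.
Proof.
have [pi H] := @choice V J (fun v q => forall p, albert_dot p q = dot (albert_emb p) v)
  (fun v => albert_riesz (fun t x y => etrans (congr1 (fun e => dot e v)
     (albert_emb_linear t x y)) (dot_linear_l _ _ _ _))).
by exists pi.
Qed.

(** An automorphism g of the Albert algebra is extended to the ambient space by
    the identity on the orthogonal complement of the embedded algebra.  The
    product B is the Jordan product of the orthogonal projections.  A vector u
    with B u u = u lies in the embedded algebra and is idempotent there, and its
    squared norm is half its trace. *)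
Lemma octonionic_model : exists B rho, linear_model (X := octonionic_plane R) B rho.
Proof.
have [pi piP] := albert_proj_exists.
have piK p : pi (albert_emb p) = p.
  by apply: albert_dot_inj => w; rewrite piP dot_albert_emb.
have pi_lin t u v : pi (t *: u + v) = t *: pi u + pi v.
  apply: albert_dot_inj => w; apply: etrans (piP _ _) _.
  apply: etrans (esym (albert_dot_linear_r t (pi u) (pi v) w)).
  by rewrite dot_linear_r !piP.
pose B (u v : V) := albert_emb (jordan (pi u) (pi v)).
have Bbil : bilinear_op B.
  split=> [v t x y|u t x y]; rewrite /B.
    by rewrite pi_lin jordan_linear_l albert_emb_linear.
  by rewrite pi_lin jordan_linear_r albert_emb_linear.
pose ext (g : J -> J) (v : V) := albert_emb (g (pi v)) + (v - albert_emb (pi v)).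
have ext_lin g : linear g -> linear (ext g).
  move=> gl t u v; rewrite /ext pi_lin (gl t (pi u) (pi v)) !albert_emb_linear.
  rewrite scalerDr scalerBr opprD.
  move: (albert_emb _) (albert_emb _) (albert_emb _) (albert_emb _) => a b c e.
  by apply/rowP => i; rewrite !mxE; ring.
pose rho (g : J -> J) := lin_matrix (ext g).
have pi_ext g v : pi (ext g v) = g (pi v).
  apply: albert_dot_inj => w; rewrite piP /ext -[albert_emb (g _)]scale1r dot_linear_r.
  rewrite -scaleN1r (addrC v) dot_linear_r !dot_albert_emb -piP; ring.
have rhoE g v : linear g -> v *m rho g = ext g v.
  by move=> gl; rewrite mul_lin_matrix//; exact: ext_lin.
have extM g h v : ext (g \o h) v = ext g (ext h v).
  have -> : ext g (ext h v) = albert_emb (g (pi (ext h v))) +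
      (ext h v - albert_emb (pi (ext h v))) by [].
  by rewrite pi_ext /ext /=; congr (_ + _); rewrite [RHS]addrC addKr.
have iso g : F4 g -> isometries B (rho g).
  move=> [gl gb gj]; split.
    apply: orthogonal_of_dot => x y; rewrite !rhoE//.
    have dot_ext (f : J -> J) u v : dot (ext f u) (ext f v) =
        albert_dot (f (pi u)) (f (pi v)) + dot (u - albert_emb (pi u)) (v - albert_emb (pi v)).
      have orth p w : dot (albert_emb p) (w - albert_emb (pi w)) = 0.
        by rewrite -scaleN1r (addrC w) dot_linear_r dot_albert_emb piP; ring.
      rewrite /ext -[albert_emb (f (pi u))]scale1r dot_linear_l.
      rewrite -[albert_emb (f (pi v))]scale1r !dot_linear_r dot_albert_emb.
      rewrite orth (dotC _ (albert_emb _)) orth; ring.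
    rewrite dot_ext (F4_dot gl gb gj).
    have ext_id w : ext idfun w = w by rewrite /ext /= addrC subrK.
    by rewrite -[in RHS](ext_id x) -[in RHS](ext_id y) (dot_ext idfun).
  move=> u v; rewrite !rhoE// /B !pi_ext -gj /ext piK.
  by rewrite subrr addr0.
have ptsE p : pts (octonionic_plane R) p <->
    B (albert_emb p) (albert_emb p) = albert_emb p /\
    dot (albert_emb p) (albert_emb p) = 2^-1.
  rewrite /B piK dot_albert_emb /=.
  have n2 : (2 : R) != 0 by rewrite pnatr_eq0.
  split=> [[pp p1]|[/(congr1 pi)]].
    split; first by rewrite pp.
    by apply: (mulfI n2); rewrite -albert_tr_jordan pp p1 mulfV.
  rewrite !piK => pp p1; split=> //.
  by rewrite -pp albert_tr_jordan p1 mulfV.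
exists B, rho; split.
- exact: Bbil.
- exact: iso.
- move=> g h [gl _ _] [hl _ _].
  have ghl : linear (g \o h) by move=> t x y; rewrite /= (hl t x y) (gl t (h x) (h y)).
  apply/row_matrixP => i; rewrite !rowE mulmxA.
  by rewrite (rhoE _ _ hl) (rhoE _ _ gl) (rhoE _ _ ghl).
- move=> g p [gl gb gj] [pp p1]; split; first by rewrite -gj pp.
  by rewrite (F4_tr gl gb gj).
- move=> g p [gl gb gj] _; rewrite rhoE// /ext piK.
  by rewrite subrr addr0.
- move=> A x BA [p /ptsE[pp p1] <-].
  (* The image of the embedding contains every value of B, and B u u = u for
     u = albert_emb p *m A. *)
  have E : albert_emb (pi (albert_emb p *m A)) = albert_emb p *m A.
    by rewrite -{1}pp -(proj2 BA) {1}/B piK -[RHS](congr1 (mulmx^~ A) pp) -(proj2 BA).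
  exists (pi (albert_emb p *m A)); last exact: E.
  apply/ptsE.
  by rewrite E (proj2 BA) pp (dot_isometry _ _ BA).
- by move=> f g h.
- by move=> f.
Qed.

End OctonionModel.

(** * Finitely many eigenvalues determine the spectrum *)

Theorem theorem1p9 (R : realType) (X : gspace R) (hX : cross X)
    (eps : R) (heps : 0 < eps) :
  exists2 N : nat, (0 < N)%N &
    forall Gam1 Gam2 : {fset elt X},
      finite_subgroup Gam1 -> finite_subgroup Gam2 ->
      (#|` Gam1|%:R : R)^-1 > eps -> (#|` Gam2|%:R : R)^-1 > eps ->
      forall u1 u2 : nat -> R,
        eigenvalue_list Gam1 u1 -> eigenvalue_list Gam2 u2 ->
        (isospectral Gam1 Gam2 <-> forall k : nat, (k < N)%N -> u1 k = u2 k).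
Proof.
case: X / hX => [n _|n _|n _|].
- exact: linear_model_spectrum_determined (sphere_model R n) _ heps.
- apply: linear_model_spectrum_determined heps.
  by apply: (conj_action_model (complex_star_ring R)) => g [].
- apply: linear_model_spectrum_determined heps.
  exact: (conj_action_model (quat_star_ring R)).
- have [B [rho mod]] := octonionic_model R.
  exact: linear_model_spectrum_determined mod _ heps.
Qed.
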